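(* Writing $\mathcal{O}=\mathcal{O}_{\mathbb{P}^3}$, there exist minimal monads on $\mathbb{P}^3$ of each of the following forms whose cohomology bundle is stable: (P8) $\ \mathcal{O}(-2)\oplus\mathcal{O}(-3)\to3\cdot\mathcal{O}\oplus3\cdot\mathcal{O}(-1)\to\mathcal{O}(1)\oplus\mathcal{O}(2)$; (P9) $\ 2\cdot\mathcal{O}(-2)\oplus\mathcal{O}(-3)\to\mathcal{O}(1)\oplus3\cdot\mathcal{O}\oplus3\cdot\mathcal{O}(-1)\oplus\mathcal{O}(-2)\to2\cdot\mathcal{O}(1)\oplus\mathcal{O}(2)$; (P10) $\ 2\cdot\mathcal{O}(-3)\to2\cdot\mathcal{O}(1)\oplus\mathcal{O}\oplus\mathcal{O}(-1)\oplus2\cdot\mathcal{O}(-2)\to2\cdot\mathcal{O}(2)$; (P12) $\ \mathcal{O}(-2)\oplus2\cdot\mathcal{O}(-3)\to3\cdot\mathcal{O}(1)\oplus\mathcal{O}\oplus\mathcal{O}(-1)\oplus3\cdot\mathcal{O}(-2)\to\mathcal{O}(1)\oplus2\cdot\mathcal{O}(2)$; (P14) $\ \mathcal{O}(-2)\oplus\mathcal{O}(-4)\to\mathcal{O}(2)\oplus2\cdot\mathcal{O}\oplus2\cdot\mathcal{O}(-1)\oplus\mathcal{O}(-3)\to\mathcal{O}(1)\oplus\mathcal{O}(3)$; (P17) $\ \mathcal{O}(-3)\oplus\mathcal{O}(-4)\to\mathcal{O}(2)\oplus2\cdot\mathcal{O}(1)\oplus2\cdot\mathcal{O}(-2)\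oplus\mathcal{O}(-3)\to\mathcal{O}(2)\oplus\mathcal{O}(3)$.
   Context: $\mathbb{P}^3$ is projective 3-space over an algebraically closed field of characteristic zero; $m\cdot\mathcal{L}$ denotes $\mathcal{L}^{\oplus m}$. Stability is slope stability. A monad is a complex of vector bundles $\mathcal{C}\xrightarrow{\beta}\mathcal{B}\xrightarrow{\alpha}\mathcal{A}$ with $\beta$ injective (and locally left invertible) and $\alpha$ surjective; its cohomology is the vector bundle $\ker\alpha/\operatorname{Im}\beta$. It is minimal if no direct summand of $\mathcal{A}$ is the image of a line subbundle of $\mathcal{B}$ and no direct summand of $\mathcal{C}$ goes onto a direct summand of $\mathcal{B}$. *)

(* Defs.v *)
From HB Require Import structures.
From mathcomp Require Import all_boot all_order all_algebra.
From mathcomp Require Import mpoly.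

Set Implicit Arguments.
Unset Strict Implicit.
Unset Printing Implicit Defensive.

Import Order.TTheory GRing.Theory Num.Theory.
Local Open Scope ring_scope.

(* Sheaves on P^3 are handled through graded modules over the homogeneous
   coordinate ring S = k[x_0, .., x_3], via Serre's correspondence: coherent
   sheaves on P^3 are finitely generated graded S-modules up to pieces of low
   degree.  A list of integers [:: b_1; ..; b_n] stands for
   O(b_1) (+) .. (+) O(b_n). *)
Section Sheaves.
Variable k : fieldType.
Local Notation S := {mpoly k[4]}.
Implicit Types a b c : seq int.

(* f lies in S_d; S_d = 0 for d < 0. *)
Definition of_degree (d : int) (f : S) : bool :=
  if d is Posz n then f \is n.-homog else f == 0.

(* Hom(B, C(d)), where Hom(O(p), O(q)) = S_(q - p). *)
Definition is_hom b c (d : int) (phi : 'M[S]_(size c, size b)) : Prop :=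
  forall (i : 'I_(size c)) (j : 'I_(size b)), of_degree (c`_i + d - b`_j) (phi i j).

(* Points of P^3 are given by homogeneous coordinates x <> 0. *)
Definition surjective_on_fibres b a (alpha : 'M[S]_(size a, size b)) : Prop :=
  forall x : 'I_4 -> k, (exists i, x i != 0) ->
  forall w : 'cV[k]_(size a), exists v : 'cV[k]_(size b),
    map_mx (fun f : S => f.@[x]) alpha *m v = w.

(* Every point has a basic open neighbourhood {h <> 0} on which gamma / h is a
   left inverse of beta.  This implies that beta is injective. *)
Definition locally_left_invertible c b (beta : 'M[S]_(size b, size c)) : Prop :=
  forall x : 'I_4 -> k, (exists i, x i != 0) ->
  exists (d : nat) (h : S) (gamma : 'M[S]_(size c, size b)),
    [/\ h \is d.-homog, h.@[x] != 0, is_hom d gamma & gamma *m beta = h%:M].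

Definition is_monad c b a
    (beta : 'M[S]_(size b, size c)) (alpha : 'M[S]_(size a, size b)) : Prop :=
  [/\ is_hom 0 beta, is_hom 0 alpha, alpha *m beta = 0,
      locally_left_invertible beta & surjective_on_fibres alpha].

(* A family of subsets N t of Gamma(B(t)) = Hom(O, B(t)), t ranging over the
   degrees. *)
Definition family b := int -> 'cV[S]_(size b) -> Prop.

Definition in_piece b (t : int) (v : 'cV[S]_(size b)) : Prop :=
  @is_hom [:: 0] b t v.

Definition graded_submodule b (N : family b) : Prop :=
  [/\ forall t v, N t v -> in_piece t v,
      forall t, N t 0,
      forall t u v, N t u -> N t v -> N t (u + v)
    & forall t d f v, of_degree d f -> N t v -> N (t + d) (f *: v)].

Definition subfamily b (M N : family b) : Prop :=
  forall t v, M t v -> N t v.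

(* Two graded submodules define the same subsheaf of B exactly when they agree
   in all large degrees. *)
Definition same_subsheaf b (M N : family b) : Prop :=
  exists t0 : int, forall t, t0 <= t -> forall v, M t v <-> N t v.

Definition kernel b a (alpha : 'M[S]_(size a, size b)) : family b :=
  fun t v => in_piece t v /\ alpha *m v = 0.

Definition image c b (beta : 'M[S]_(size b, size c)) : family b :=
  fun t v => exists2 u : 'cV[S]_(size c), in_piece t u & v = beta *m u.

(* The nonzero direct summands of A are the images of the nonzero idempotent
   endomorphisms of A. *)
Definition nonzero_projector a (e : 'M[S]_(size a, size a)) : Prop :=
  [/\ @is_hom a a 0 e, e *m e = e & e != 0].

(* As Pic P^3 = Z, a line subbundle of B is the image of a locally left
   invertible O(d) -> B. *)
Definition is_minimal c b a
    (beta : 'M[S]_(size b, size c)) (alpha : 'M[S]_(size a, size b)) : Prop :=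
  (~ exists (d : int) (l : 'M[S]_(size b, size [:: d]))
            (e : 'M[S]_(size a, size a)),
       [/\ is_hom 0 l, locally_left_invertible l, nonzero_projector e
         & same_subsheaf (@image [:: d] a (alpha *m l)) (image e)]) /\
  (~ exists (e : 'M[S]_(size c, size c)) (f : 'M[S]_(size b, size b)),
       [/\ nonzero_projector e, nonzero_projector f
         & same_subsheaf (image (beta *m e)) (image f)]).

(* dim_k (P / Q) = n, for k-subspaces Q <= P of S^m. *)
Definition quotient_dim m (P Q : 'cV[S]_m -> Prop) (n : nat) : Prop :=
  exists e : 'I_n -> 'cV[S]_m,
    [/\ forall i, P (e i),
        forall v, P v ->
          exists z : 'I_n -> k, Q (v - \sum_i (z i)%:MP *: e i)
      & forall z : 'I_n -> k,
          Q (\sum_i (z i)%:MP *: e i) -> forall i, z i = 0].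

(* p is the Hilbert polynomial of the sheaf of N / I: for t large,
   chi((N / I)~(t)) = dim (N / I)_t. *)
Definition hilbert_polynomial b (N I : family b) (p : {poly rat}) : Prop :=
  exists t0 : nat, forall t : nat, (t0 <= t)%N ->
    exists2 n : nat, quotient_dim (N t%:Z) (I t%:Z) n & p.[t%:R] = n%:R.

(* Rank and degree (= c_1) of a coherent sheaf F on P^3 whose Hilbert polynomial
   is \sum_i alpha_i(F) t^i / i!, namely
     rk F  = alpha_3(F) / alpha_3(O),
     deg F = alpha_2(F) - rk F * alpha_2(O),
   with alpha_3(O) = 1 and alpha_2(O) = 2, since chi(O(t)) = 'C(t + 3, 3). *)
Definition sheaf_rank (p : {poly rat}) : rat := 3`!%:R * p`_3.
Definition sheaf_degree (p : {poly rat}) : rat :=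
  2`!%:R * p`_2 - 2%:R * sheaf_rank p.
Definition slope (p : {poly rat}) : rat := sheaf_degree p / sheaf_rank p.

(* Slope stability of the sheaf E of K / I.  The coherent subsheaves of E are
   the sheaves of N / I with N a graded submodule, I <= N <= K; each has a
   Hilbert polynomial (Hilbert-Serre), and only one. *)
Definition slope_stable b (K I : family b) : Prop :=
  exists2 q, hilbert_polynomial K I q &
  forall (N : family b) (p : {poly rat}),
    graded_submodule N -> subfamily I N -> subfamily N K ->
    hilbert_polynomial N I p ->
    0 < sheaf_rank p < sheaf_rank q -> slope p < slope q.

Definition has_minimal_monad_with_stable_cohomology c b a : Prop :=
  exists (beta : 'M[S]_(size b, size c)) (alpha : 'M[S]_(size a, size b)),
    [/\ is_monad beta alpha, is_minimal beta alpha
      & slope_stable (kernel alpha) (image beta)].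

End Sheaves.

(* Main.v *)
Require Import Defs.
From HB Require Import structures.
From mathcomp Require Import all_boot all_order all_algebra.
From mathcomp Require Import mpoly ring lra zify.
From Stdlib Require Import Classical.

(** All six bundles E have rank 2 and first Chern class -1, and they are given by
explicit monads.

Stability.  A subsheaf of E of rank 1 is contained in a saturated one, and over
the factorial ring S a saturated subsheaf of rank 1 is S s = O(-e) for a
homogeneous section s of E(e).  If E has no section, then e > 0, so the
subsheaf has slope at most -1, less than the slope -1/2 of E.  Everything is
done on the module K / I, where K is the kernel of alpha and I the image of
beta, which is the module of sections of all E(t).  Its elements are controlled
on the charts X_i <> 0, where beta has a left inverse, and the Koszul complex
of the powers of the variables glues: this shows that K / I is torsion free
([in_image_torsion_free]) and that it remains so modulo a prime
([prime_in_image]), whence [rank_one_generator].  Slopes are read off by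
squeezing the dimensions of the graded pieces between those of two line bundles
([sub_rank_one], [sub_slope]).

Minimality.  No entry of alpha or beta has a nonzero constant term, whereas a
nonzero idempotent of a graded free module has one.  On two charts a summand
that is an image under alpha or beta would be given by a column without
constant terms ([no_summand_image]).

The monads.  They are self-dual: B is isomorphic to its dual twisted by -1,
through an alternating form J, and beta is J alpha^T.  So everything is
determined by alpha, whose rows must be orthogonal for J.  The matrices
[rows8], .., [rows17] are sparse, and for each of them three facts are checked
by computation.  The rows are orthogonal.  Some power of each variable, times
the identity, factors through alpha; this is shown for one variable at a time,
modulo the variables that are already treated ([chain_okP]), and it gives both
the surjectivity of alpha and, with the dual data, the local left inverses of
beta.
Finally alpha is injective on the sections of B, so E has none
([injective_degree0P]). *)

Set Implicit Arguments.
Unset Strict Implicit.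
Unset Printing Implicit Defensive.

Import Order.TTheory GRing.Theory Num.Theory.
Local Open Scope ring_scope.
Local Notation image := Defs.image.

(** * Factorial rings *)

Definition divides (R : comPzRingType) (p a : R) := exists c, a = p * c.

Definition prime_elt (R : comUnitRingType) (p : R) :=
  [/\ p != 0, p \isn't a GRing.unit
    & forall a b, divides p (a * b) -> divides p a \/ divides p b].

Definition prime_product (R : comUnitRingType) (l : seq R) (a : R) :=
  (forall p, p \in l -> prime_elt p) /\
  exists2 u : R, u \is a GRing.unit & a = u * \prod_(p <- l) p.

(** The factors are prime, not merely irreducible, so that uniqueness of the
factorization comes for free. *)
Definition factorial_ring (R : comUnitRingType) :=
  forall a : R, a != 0 -> exists l, prime_product l a.

Section PrimeProducts.
Variable R : idomainType.
Implicit Types (a b c p u : R) (l : seq R).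

Lemma prime_product_nil u : u \is a GRing.unit -> prime_product [::] u.
Proof. by move=> uu; split=> //; exists u => //; rewrite big_nil mulr1. Qed.

Lemma prime_product_cons p l a :
  prime_product (p :: l) a ->
  prime_elt p /\ exists2 b, a = p * b & prime_product l b.
Proof.
case=> lP [u uu ->]; split; first by apply: lP; rewrite mem_head.
exists (u * \prod_(q <- l) q); first by rewrite big_cons mulrCA.
by split; [move=> q ql; apply: lP; rewrite inE ql orbT | exists u].
Qed.

Lemma cons_prime_product p l a :
  prime_elt p -> prime_product l a -> prime_product (p :: l) (p * a).
Proof.
move=> pP [lP [u uu ->]]; split; last by exists u; rewrite // big_cons mulrCA.
by move=> q; rewrite inE => /orP[/eqP->|/lP].
Qed.

Lemma prime_product_mul l1 l2 a b :
  prime_product l1 a -> prime_product l2 b -> prime_product (l1 ++ l2) (a * b).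
Proof.
move=> [l1P [u uu ->]] [l2P [v vu ->]]; split.
  by move=> q; rewrite mem_cat => /orP[/l1P|/l2P].
by exists (u * v); rewrite ?unitrM ?uu // big_cat /= mulrACA.
Qed.

(** A prime that divides a product of primes is associated to one of them, which
can then be removed.  The length of a factorization thus bounds how many primes
can be divided out successively. *)
Lemma prime_product_div p a l :
  prime_elt p -> prime_product l (p * a) ->
  exists2 l', prime_product l' a & (size l' < size l)%N.
Proof.
case=> p0 pu pP; elim: l a => [|q l IHl] a.
  case=> _ [u uu]; rewrite big_nil mulr1 => eqp.
  by move: uu; rewrite -eqp unitrM (negbTE pu).
case/prime_product_cons=> qP [b eqb lb].
have [] := pP q b; first by exists a.
  case=> c eqc; have [q0 qu qPP] := qP.
  have [] := qPP p c; first by exists 1; rewrite mulr1.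
    case=> d eqd; have cu : c \is a GRing.unit.
      apply/unitrP; exists d; suff dc1 : d * c = 1 by rewrite [c * d]mulrC dc1.
      by apply: (mulfI q0); rewrite mulr1 mulrA -eqd -eqc.
    exists l => //; case: lb => lP [u uu eqb']; split=> //.
    exists (c * u); first by rewrite unitrM cu.
    by apply: (mulfI p0); rewrite eqb eqb' eqc !mulrA.
  case=> d eqd; case/negP: pu; apply/unitrP; exists d.
  suff pd1 : p * d = 1 by rewrite [d * p]mulrC pd1.
  by apply: (mulfI q0); rewrite mulr1 mulrCA -eqd.
case=> c eqc; have [|l' l'c sl'] := IHl c; first by rewrite -eqc.
exists (q :: l'); last by rewrite /= ltnS.
suff -> : a = q * c by apply: cons_prime_product.
by apply: (mulfI p0); rewrite eqb eqc mulrCA.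
Qed.

End PrimeProducts.

Section Gauss.
Variable R : idomainType.
Hypothesis Rfact : factorial_ring R.
Implicit Types (f g h q : {poly R}) (p c : R).

Let divC p c f : divides p%:P f -> divides p c ->
  divides p%:P (f * 'X + c%:P).
Proof.
by case=> g -> [d ->]; exists (g * 'X + d%:P); rewrite mulrDr mulrA polyCM.
Qed.

Let dividesX p f : divides p%:P (f * 'X) -> divides p%:P f.
Proof.
case=> g eqg; have g0 : p * g`_0 = 0.
  by rewrite -coefCM -eqg coefMX.
elim/poly_ind: g eqg g0 => [|g c _] eqg.
  move=> _; exists 0; rewrite mulr0; apply/eqP.
  by move: eqg => /eqP; rewrite mulr0 mulf_eq0 polyX_eq0 orbF.
rewrite coefD coefMX coefC /= add0r => pc0; exists g.
apply: (mulIf (negbT (polyX_eq0 R))); rewrite eqg mulrDr -polyCM pc0 addr0.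
by rewrite mulrA.
Qed.

(** This is the statement that (R / p)[X] is a domain.  The induction removes
constant terms: that of f g is the product of those of f and g, so p divides
one of these, and the corresponding factor may be replaced by its quotient by
'X. *)
Lemma prime_polyC p : prime_elt p -> prime_elt p%:P.
Proof.
case=> p0 pu pP; split; first by rewrite polyC_eq0.
  by rewrite poly_unitE coefC /= (negbTE pu) andbF.
elim/poly_ind=> [|f a IHf] g; first by left; exists 0; rewrite mulr0.
have dvd_eq h1 h2 : divides p%:P (h1 * h2) -> divides p (h1`_0 * h2`_0).
  case=> h /(congr1 (fun r : {poly R} => r`_0)); rewrite coef0M coefCM => ->.
  by exists h`_0.
have [pa|npa] := classic (divides p a).
  move=> dfg; have [|pf|pg] := IHf g; last by right.
  - apply: dividesX; case: dfg => h eqh; case: pa => b eqb.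
    exists (h - b%:P * g); rewrite mulrBr -eqh mulrA -polyCM -eqb.
    by rewrite mulrDl addrK mulrAC.
  - by left; apply: divC.
elim/poly_ind: g => [|g b IHg] dfg; first by right; exists 0; rewrite mulr0.
have := dvd_eq _ _ dfg.
rewrite !coefD !coefMX !coefC /= !add0r => /pP[//|pb].
have [|pf|pg] := IHg; [| by left | by right; apply: divC].
apply: dividesX; case: dfg => h eqh; case: pb => d eqd.
exists (h - d%:P * (f * 'X + a%:P)); rewrite mulrBr -eqh [p%:P * (_ * _)]mulrA.
by rewrite -polyCM -eqd mulrDr [b%:P * _]mulrC addrK mulrA.
Qed.

Definition primitive_poly f := forall p, prime_elt p -> ~ divides p%:P f.


(** Primes are divided out of f as long as possible.  Each of them also divides the
leading coefficient, whose factorization has finite length. *)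
Lemma content_split f :
  f != 0 ->
  exists c g, [/\ c != 0, f = c%:P * g, g != 0 & primitive_poly g].
Proof.
move=> f0; have [l] : exists l, prime_product l (lead_coef f).
  by apply: Rfact; rewrite lead_coef_eq0.
have [n] := ubnP (size l); elim: n => // n IHn in f f0 l *.
rewrite ltnS => szl lf.
have [fprim|nfprim] := classic (primitive_poly f).
  by exists 1, f; rewrite oner_neq0 mul1r.
have [p nfp] := not_all_ex_not _ _ nfprim.
have [pP /NNPP[g eqf]] := imply_to_and _ _ nfp.
have [p0 g0] : p != 0 /\ g != 0.
  by move: f0; rewrite eqf mulf_eq0 polyC_eq0 => /norP.
move: lf; rewrite eqf lead_coefM lead_coefC => lf.
have [l' lg szl'] := prime_product_div pP lf.
have [c [h [c0 eqg h0 hP]]] := IHn _ g0 _ (leq_trans szl' szl) lg.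
by exists (p * c), h; rewrite mulf_neq0 // eqg mulrA polyCM.
Qed.

(** Divisibility by g over the fraction field of R descends to R: a prime factor of
the denominator c divides q g, hence q, as it cannot divide g. *)
Lemma primitive_div c q f g :
  primitive_poly g -> c != 0 -> c%:P * f = q * g -> divides g f.
Proof.
move=> gP c0; have [l lc] := Rfact c0.
elim: l => [|p l IHl] in c c0 lc q *.
  case: lc => _ [u uu]; rewrite big_nil mulr1 => -> eqf.
  exists ((u^-1)%:P * q); rewrite mulrCA [g * _]mulrC -eqf mulrA -polyCM.
  by rewrite mulVr // mul1r.
have [pP [d eqc ld]] := prime_product_cons lc.
move: c0; rewrite eqc mulf_eq0 => /norP[p0 d0] eqf.
have [_ _ pPP] := prime_polyC pP.
have [|[r eqq]|/(gP _ pP)//] := pPP q g.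
- by exists (d%:P * f); rewrite -eqf polyCM mulrA.
- apply: (IHl d d0 ld r); apply: (mulfI (x := p%:P)); first by rewrite polyC_eq0.
  by rewrite !mulrA -polyCM eqf eqq.
Qed.

(** A factorization of f over the fraction field of R, with denominators cleared by
c, descends to R: each prime factor of c divides q or d. *)
Lemma primitive_split c f q d :
  primitive_poly f -> c != 0 -> c%:P * f = q * d ->
  exists q' d', [/\ f = q' * d', size q' = size q & size d' = size d].
Proof.
move=> fP c0; have [l lc] := Rfact c0.
elim: l => [|p l IHl] in c c0 lc q d *.
  case: lc => _ [u uu]; rewrite big_nil mulr1 => -> eqf.
  exists ((u^-1)%:P * q), d; rewrite -mulrA -eqf mulrA -polyCM mulVr // mul1r.
  split=> //; rewrite mul_polyC size_scale // invr_eq0.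
  by apply: contraTneq uu => ->; rewrite unitr0.
have [pP [b eqc lb]] := prime_product_cons lc.
move: c0; rewrite eqc mulf_eq0 => /norP[p0 b0] eqf.
have pp0 : p%:P != 0 :> {poly R} by rewrite polyC_eq0.
have [_ _ pPP] := prime_polyC pP.
have [|[r eqr]|[r eqr]] := pPP q d.
- by exists (b%:P * f); rewrite -eqf polyCM mulrA.
- have [|q' [d' [eqf' s1 s2]]] := IHl b b0 lb r d.
    by apply: (mulfI pp0); rewrite !mulrA -polyCM eqf eqr.
  by exists q', d'; rewrite s1 s2 eqr mul_polyC size_scale.
- have [|q' [d' [eqf' s1 s2]]] := IHl b b0 lb q r.
    by apply: (mulfI pp0); rewrite !mulrA -polyCM eqf eqr mulrCA mulrA.
  by exists q', d'; rewrite s1 s2 eqr mul_polyC size_scale.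
Qed.

Lemma prime_product_polyC l c :
  prime_product l c -> prime_product [seq p%:P | p <- l] (c%:P : {poly R}).
Proof.
case=> lP [u uu ->]; split.
  by move=> _ /mapP[p /lP pP ->]; apply: prime_polyC.
exists u%:P; last by rewrite polyCM rmorph_prod big_map.
exact: (rmorph_unit (@polyC R)).
Qed.

(** Gauss.  The content factors in R.  A primitive polynomial either is a product
of two polynomials of lower degree or is prime: for the gcd d of g and a over
the fraction field of R, either d is constant and g divides b by the theory of
coprime polynomials over a field, or d has the degree of g and g divides a. *)
Lemma factorial_poly : factorial_ring {poly R}.
Proof.
move=> f; have [n] := ubnP (size f); elim: n f => // n IHn f.
rewrite ltnS => szf f0.
have [c [g [c0 eqf g0 gP]]] := content_split f0.
have [l1 /prime_product_polyC l1c] := Rfact c0.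
suff [l2 l2g] : exists l, prime_product l g.
  by exists (map polyC l1 ++ l2); rewrite eqf; apply: prime_product_mul.
have szg : (size g <= n)%N.
  by rewrite (leq_trans _ szf) // eqf mul_polyC size_scale.
have [/size1_polyC eqg|sz1] := leqP (size g) 1.
  have b0 : g`_0 != 0 by rewrite -polyC_eq0 -eqg.
  have [l /prime_product_polyC lb] := Rfact b0; exists (map polyC l).
  by rewrite eqg.
have [[h1 [h2 [eqg h1s h2s]]]|irr] := classic (exists h1 h2,
    [/\ g = h1 * h2, (1 < size h1)%N & (1 < size h2)%N]).
  have h10 : h1 != 0 by apply: contraTneq h1s => ->; rewrite size_poly0.
  have h20 : h2 != 0 by apply: contraTneq h2s => ->; rewrite size_poly0.
  have szs := size_mul h10 h20; rewrite -eqg in szs.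
  have [|l2 l2P] := IHn h1 _ h10; first by lia.
  have [|l3 l3P] := IHn h2 _ h20; first by lia.
  by exists (l2 ++ l3); rewrite eqg; apply: prime_product_mul.
exists [:: g]; rewrite -[X in prime_product _ X]mulr1.
apply: cons_prime_product; last by apply: prime_product_nil; apply: unitr1.
split=> //; first by rewrite poly_unitE gtn_eqF.
move=> a b [h eqab]; pose d := gcdp g a.
have d0 : d != 0 by rewrite gcdp_eq0 negb_and g0.
have [[e q] /= e0 eqd] := Pdiv.Idomain.dvdpP _ _ (dvdp_gcdl g a).
rewrite -mul_polyC in eqd.
have [q' [d' [eqg szq szd]]] := primitive_split gP e0 eqd.
have [szd1|szd1] := leqP (size d) 1.
  right; have cop : coprimep g a.
    by rewrite coprimep_def eqn_leq szd1 size_poly_gt0.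
  have : g %| a * b by rewrite eqab dvdp_mulr.
  rewrite Gauss_dvdpr // => /Pdiv.Idomain.dvdpP[[e1 r] /= e10].
  by rewrite -mul_polyC; apply: primitive_div.
left; have q0 : q' != 0 by apply: contraNneq g0 => q0; rewrite eqg q0 mul0r.
have szq1 : (size q' <= 1)%N.
  by rewrite leqNgt; apply/negP => szq1; apply: irr; exists q', d'; rewrite szd.
have d'0 : d' != 0 by rewrite -size_poly_gt0 szd size_poly_gt0.
have : g %= d.
  have szg' : size g = (size q' + size d').-1 by rewrite -size_mul // -eqg.
  rewrite eqp_sym -(dvdp_size_eqp (dvdp_gcdl g a)) -/d szg' -szd.
  by move: q0; rewrite -size_poly_gt0; lia.
move=> /eqp_dvdl gd; have : g %| a by rewrite gd dvdp_gcdr.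
move=> /Pdiv.Idomain.dvdpP[[e1 r] /= e10].
by rewrite -mul_polyC; apply: primitive_div.
Qed.

End Gauss.

Lemma factorial_iso (R S : comUnitRingType) (f : {rmorphism R -> S})
    (g : {rmorphism S -> R}) :
  cancel f g -> cancel g f -> factorial_ring R -> factorial_ring S.
Proof.
move=> fK gK Rfact a a0.
have unitf x : (f x \is a GRing.unit) = (x \is a GRing.unit).
  by apply/idP/idP => [/(rmorph_unit g)|/(rmorph_unit f)] //; rewrite fK.
have [|l [lP [u uu eqa]]] := Rfact (g a).
  by rewrite -(inj_eq (can_inj fK)) gK rmorph0.
exists (map f l); split; last first.
  exists (f u); first by rewrite unitf.
  by rewrite big_map -rmorph_prod -rmorphM -eqa gK.
move=> _ /mapP[p /lP[p0 pu pP] ->]; split; rewrite ?unitf //.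
  by rewrite -(inj_eq (can_inj gK)) fK rmorph0.
move=> b c [d eqd]; have [|[e eqe]|[e eqe]] := pP (g b) (g c).
- by exists (g d); rewrite -rmorphM eqd rmorphM fK.
- by left; exists (f e); rewrite -rmorphM -eqe gK.
- by right; exists (f e); rewrite -rmorphM -eqe gK.
Qed.

Section MultiPoly.
Variable k : fieldType.

Local Notation widen := (widen_ord (leqnSn _)).

Definition mpoly_of_poly n : {poly {mpoly k[n]}} -> {mpoly k[n.+1]} :=
  horner_eval 'X_ord_max \o map_poly (@mwiden n k).

HB.instance Definition _ n := GRing.RMorphism.on (@mpoly_of_poly n).

Lemma muni_mwiden n (p : {mpoly k[n]}) : muni (mwiden p) = p%:P.
Proof.
elim/mpolyind: p => [|c m p _ _ IHp]; first by rewrite mwiden0 muni0.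
rewrite mwidenD mwidenZ mwidenX muniD IHp muniZ polyCD; congr (_ + _).
rewrite muniE msuppX big_seq1 mcoeffX eqxx scale1r mnmwiden_ordmax expr0.
rewrite alg_polyC -mul_polyC -mul_mpolyC polyCM; congr (_ * _%:P).
by congr 'X_[_]; apply/mnmP => i; rewrite mnmE mnmwiden_widen.
Qed.

Lemma muniX n (m : 'X_{1..n.+1}) : muni 'X_[m] =
  'X_[[multinom m (widen i) | i < n]] *: 'X^(m ord_max) :> {poly {mpoly k[n]}}.
Proof. by rewrite muniE msuppX big_seq1 mcoeffX eqxx scale1r. Qed.

Lemma mpoly_of_polyK n : cancel (@mpoly_of_poly n) (@muni n k).
Proof.
elim/poly_ind => [|p c IHp]; first by rewrite rmorph0 muni0.
rewrite rmorphD rmorphM /= muniD muniM IHp; congr (_ * _ + _).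
  rewrite /mpoly_of_poly /= map_polyX /horner_eval hornerX muniX mnmE eqxx.
  rewrite expr1 -[RHS]scale1r -mpolyX0; congr ('X_[_] *: _).
  apply/mnmP => i; rewrite !mnmE; case: eqP => // /(congr1 val) /= eqi.
  by have := ltn_ord i; rewrite -eqi ltnn.
by rewrite /mpoly_of_poly /= map_polyC /horner_eval hornerC muni_mwiden.
Qed.

Lemma muniK n : cancel (@muni n k) (@mpoly_of_poly n).
Proof.
elim/mpolyind => [|c m p _ _ IHp]; first by rewrite muni0 rmorph0.
rewrite muniD [LHS](rmorphD (@mpoly_of_poly n)) [X in _ + X]IHp.
congr (_ + _).
rewrite muniZ muniX -!mul_polyC !rmorphM rmorphXn /= /mpoly_of_poly /=.
rewrite !map_polyC map_polyX /horner_eval !hornerC hornerX /= mwidenC mwidenX.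
rewrite mul_mpolyC mpolyXn -mpolyXD; congr (_ *: 'X_[_]).
apply/mnmP => i; rewrite mnmDE mulmnE mnm1E.
have [j ->|->] := unliftP ord_max i.
  have -> : lift ord_max j = widen j by apply: val_inj; exact: lift_max.
  rewrite mnmwiden_widen mnmE; case: eqP => [/(congr1 val) /= eqi|_].
    by have := ltn_ord j; rewrite -eqi ltnn.
  by rewrite mul0n addn0.
by rewrite mnmwiden_ordmax eqxx mul1n.
Qed.

Lemma factorial_mpoly n : factorial_ring {mpoly k[n]}.
Proof.
elim: n => [|n IHn]; last first.
  exact: factorial_iso (@mpoly_of_polyK n) (@muniK n) (factorial_poly IHn).
move=> a a0; exists [::]; apply: prime_product_nil.
have eqa : a = (a@_0)%:MP.
  apply/mpolyP => m; rewrite mcoeffC; suff -> : m = 0%MM by rewrite eqxx mulr1.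
  by apply/mnmP; case.
rewrite eqa rmorph_unit // unitfE; apply: contraNneq a0 => a00.
by rewrite eqa a00 mpolyC0.
Qed.

End MultiPoly.

(** * Koszul syzygies and the module of sections *)

Lemma scalemx_cancel (R : idomainType) m n (f : R) (A B : 'M[R]_(m, n)) :
  f != 0 -> f *: A = f *: B -> A = B.
Proof.
move=> f0 /matrixP eqAB; apply/matrixP => i j; apply: (mulfI f0).
by have := eqAB i j; rewrite !mxE.
Qed.

Lemma prime_div_col (R : comUnitRingType) n (p g : R) (u v : 'cV[R]_n) :
  prime_elt p -> ~ divides p g -> g *: u = p *: v -> exists w, u = p *: w.
Proof.
move=> [_ _ pP] npg /matrixP equ.
have /fin_all_exists[w wP] t : exists z, u t 0 = p * z.
  have := equ t 0; rewrite !mxE => eqt.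
  by have [|//|[z ->]] := pP g (u t 0); [exists (v t 0) | exists z].
by exists (\col_t w t); apply/colP => t; rewrite !mxE.
Qed.

Lemma col_sum_delta (R : pzRingType) n (w : 'cV[R]_n) :
  w = \sum_j w j 0 *: delta_mx j 0.
Proof.
apply/colP => i; rewrite summxE (bigD1 i) //= !mxE !eqxx mulr1.
by rewrite big1 ?addr0 // => j ji; rewrite !mxE eq_sym (negbTE ji) mulr0.
Qed.

Section Koszul.
Variables (k : fieldType) (n : nat).
Local Notation S := {mpoly k[n]}.
Implicit Types (i j l : 'I_n) (u p q : S).

Lemma mcoeff_varX_mul0 i a p (m : 'X_{1..n}) :
  (m i < a)%N -> ('X_i ^+ a * p)@_m = 0.
Proof.
move=> mia; apply/eqP; rewrite mcoeff_eq0; apply/negP.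
rewrite mpolyXn mulrC (perm_mem (msuppMX _ _)) => /mapP[m' _ eqm].
by move: mia; rewrite eqm mnmDE mulmnE mnm1E eqxx mul1n ltnNge leq_addr.
Qed.

Lemma varX_factor i a (m : 'X_{1..n}) : (a <= m i)%N ->
  'X_[m] = 'X_i ^+ a * 'X_[m - U_(i) *+ a] :> S.
Proof.
move=> am; rewrite mpolyXn -mpolyXD addmC submK //.
apply/mnm_lepP => t; rewrite mulmnE mnm1E.
by case: eqP => [<-|]; rewrite ?mul1n ?mul0n.
Qed.

(** Exactness of the Koszul complex of three powers of variables (of two if i = j).
A monomial of u divisible by neither X_i^a nor X_j^b would give such a monomial
of X_l^c u, as l is neither i nor j. *)
Lemma koszul_exact i j l a b c u p q :
  l != i -> l != j -> 'X_l ^+ c * u = 'X_i ^+ a * p + 'X_j ^+ b * q ->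
  exists p' q', u = 'X_i ^+ a * p' + 'X_j ^+ b * q'.
Proof.
move=> li lj equ; rewrite [u]mpolyE big_seq.
apply: (big_ind (fun w => exists p' q', w = 'X_i ^+ a * p' + 'X_j ^+ b * q')).
- by exists 0, 0; rewrite !mulr0 addr0.
- move=> _ _ [p1 [q1 ->]] [p2 [q2 ->]]; exists (p1 + p2), (q1 + q2).
  by rewrite !mulrDr addrACA.
move=> m; have div_X i' a' : (a' <= m i')%N ->
    exists p', u@_m *: 'X_[m] = 'X_i' ^+ a' * p' :> S.
  move=> am; exists (u@_m *: 'X_[m - U_(i') *+ a']).
  by rewrite -scalerAr -varX_factor.
have [/div_X[p' ->] _|mi] := leqP a (m i).
  by exists p', 0; rewrite mulr0 addr0.
have [/div_X[q' ->] _|mj] := leqP b (m j).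
  by exists 0, q'; rewrite mulr0 add0r.
rewrite mcoeff_msupp => /eqP[]; rewrite -(mcoeffMX u (U_(l) *+ c) m) mulrC addmC.
rewrite -mpolyXn equ mcoeffD !mcoeff_varX_mul0 ?addr0 //.
  by rewrite mnmDE mulmnE mnm1E (negbTE lj) mul0n addn0.
by rewrite mnmDE mulmnE mnm1E (negbTE li) mul0n addn0.
Qed.

Lemma varX_neq0 i a : 'X_i ^+ a != 0 :> S.
Proof. by rewrite mpolyXn -msize_poly_eq0 msizeX. Qed.

Lemma varX_coprime r i j a b (v w : 'cV[S]_r) :
  i != j -> 'X_j ^+ b *: w = 'X_i ^+ a *: v -> exists z, w = 'X_i ^+ a *: z.
Proof.
move=> ij eqw.
have /fin_all_exists[z zP] : forall s, exists z, w s 0 = 'X_i ^+ a * z.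
  move=> s; have [|||p' [q' ->]] := @koszul_exact i i j a a b (w s 0) (v s 0) 0.
  - by rewrite eq_sym.
  - by rewrite eq_sym.
  - by have /matrixP/(_ s 0) := eqw; rewrite !mxE mulr0 addr0.
  by exists (p' + q'); rewrite mulrDr.
by exists (\col_s z s); apply/colP => s; rewrite !mxE zP.
Qed.

Lemma koszul_exact_col r i j l a b c (u p q : 'cV[S]_r) :
  l != i -> l != j -> 'X_l ^+ c *: u = 'X_i ^+ a *: p + 'X_j ^+ b *: q ->
  exists p' q' : 'cV[S]_r, u = 'X_i ^+ a *: p' + 'X_j ^+ b *: q'.
Proof.
move=> li lj equ.
have /fin_all_exists[z zP] s : exists z : S * S,
    u s 0 = 'X_i ^+ a * z.1 + 'X_j ^+ b * z.2.
  have /matrixP/(_ s 0) := equ; rewrite !mxE => /(koszul_exact li lj).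
  by case=> p' [q' ->]; exists (p', q').
exists (\col_s (z s).1), (\col_s (z s).2).
by apply/colP => s; rewrite !mxE zP.
Qed.

End Koszul.

(** The kernel K of alpha and the image I of beta are taken here without gradings.
Since beta is split on each chart X_i <> 0, the quotient K / I behaves like the
sections of a vector bundle on the punctured affine space. *)
Section Torsion.
Variables (k : fieldType) (nc nb na : nat).
Local Notation S := {mpoly k[4]}.
Variables (beta : 'M[S]_(nb, nc)) (alpha : 'M[S]_(na, nb)).
Hypothesis ab0 : alpha *m beta = 0.
Hypothesis gammaP : forall i : 'I_4, exists N (gamma : 'M[S]_(nc, nb)),
  gamma *m beta = ('X_i ^+ N)%:M.
Implicit Types (u v w s : 'cV[S]_nb) (f g : S).

Definition in_image v := exists c, v = beta *m c.

Lemma in_image0 : in_image 0. Proof. by exists 0; rewrite mulmx0. Qed.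

Lemma in_imageD u v : in_image u -> in_image v -> in_image (u + v).
Proof. by case=> c -> [d ->]; exists (c + d); rewrite mulmxDr. Qed.

Lemma in_imageZ f v : in_image v -> in_image (f *: v).
Proof. by case=> c ->; exists (f *: c); rewrite scalemxAr. Qed.

Lemma in_imageN v : in_image v -> in_image (- v).
Proof. by rewrite -scaleN1r; apply: in_imageZ. Qed.

Lemma in_imageB u v : in_image u -> in_image v -> in_image (u - v).
Proof. by move=> uI vI; apply: in_imageD (in_imageN vI). Qed.

Lemma in_image_sum I r (P : pred I) (F : I -> 'cV[S]_nb) :
  (forall i, P i -> in_image (F i)) -> in_image (\sum_(i <- r | P i) F i).
Proof. by move=> FI; apply: (big_ind in_image in_image0 in_imageD). Qed.

Lemma beta_inj (c d : 'cV[S]_nc) : beta *m c = beta *m d -> c = d.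
Proof.
have [N [gamma gb]] := gammaP 0; move=> /(congr1 (mulmx gamma)).
by rewrite !mulmxA gb !mul_scalar_mx => /(scalemx_cancel (varX_neq0 _ _ _)).
Qed.

(** If f v = beta u, then u / f is regular on the chart X_i <> 0, since a left
inverse of beta maps v to it.  Two charts suffice for u / f to be a
polynomial. *)
Lemma in_image_torsion_free f v : f != 0 -> in_image (f *: v) -> in_image v.
Proof.
move=> f0 [u equ].
have [N0 [g0 g0P]] := gammaP (inord 0); have [N1 [g1 g1P]] := gammaP (inord 1).
set h0 := 'X_(inord 0) ^+ N0 in g0P; set h1 := 'X_(inord 1) ^+ N1 in g1P.
have e0 : f *: (g0 *m v) = h0 *: u.
  by rewrite scalemxAr equ mulmxA g0P mul_scalar_mx.
have e1 : f *: (g1 *m v) = h1 *: u.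
  by rewrite scalemxAr equ mulmxA g1P mul_scalar_mx.
have [||c eqc] :=
  @varX_coprime k 4 nc (inord 0) (inord 1) N0 N1 (g1 *m v) (g0 *m v).
- by rewrite -val_eqE /= !inordK.
- apply: (scalemx_cancel f0); rewrite -/h0 -/h1.
  have swap h (x : 'cV_nc) : f *: (h *: x) = h *: (f *: x).
    by rewrite !scalerA mulrC.
  by rewrite !swap e0 e1 !scalerA mulrC.
exists c; apply: (scalemx_cancel (varX_neq0 _ (inord 0) N0)).
apply: (scalemx_cancel f0).
rewrite -/h0 in eqc *.
rewrite [h0 *: (beta *m c)]scalemxAr -eqc [RHS]scalemxAr e0 scalerA mulrC.
by rewrite -scalerA equ scalemxAr.
Qed.

(** K / I is torsion free modulo a prime p.  On the chart X_i <> 0, K is the sum of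
I and of its intersection with the kernel of a left inverse of beta, where p
can be divided out; this gives w_i with X_i^N s = p w_i modulo I.  The
differences of these local solutions are a cocycle with values in the free
module of which I is the image, and Koszul exactness on three charts makes it a
coboundary, so the w_i can be modified to glue. *)
Lemma prime_in_image p g s v :
  prime_elt p -> ~ divides p g -> alpha *m s = 0 -> alpha *m v = 0 ->
  in_image (g *: s - p *: v) ->
  exists2 w, alpha *m w = 0 & in_image (s - p *: w).
Proof.
move=> [p0 pu pP] npg sK vK [c eqc].
have step i : exists N w, alpha *m w = 0 /\ in_image ('X_i ^+ N *: s - p *: w).
  have [N [gm gmP]] := gammaP i; exists N.
  set h := 'X_i ^+ N in gmP *.
  pose proj (x : 'cV[S]_nb) : 'cV[S]_nb := h *: x - beta *m (gm *m x).
  have projI c' : proj (beta *m c') = 0.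
    by rewrite /proj [gm *m _]mulmxA gmP mul_scalar_mx scalemxAr subrr.
  have eqgp : g *: proj s = p *: proj v.
    apply/subr0_eq; rewrite -(projI c) -eqc /proj !mulmxBr -!scalemxAr !scalerBr.
    rewrite !scalerA [g * h]mulrC [p * h]mulrC !opprB.
    by rewrite [_ - _ *: v]addrC addrACA [- _ + _]addrC.
  have projK x : alpha *m x = 0 -> alpha *m proj x = 0.
    move=> xK; rewrite mulmxBr -scalemxAr xK scaler0.
    by rewrite [alpha *m (beta *m _)]mulmxA ab0 mul0mx subr0.
  have [w eqw] := prime_div_col (And3 p0 pu pP) npg eqgp.
  exists w; split.
    by apply: (scalemx_cancel p0); rewrite scaler0 scalemxAr -eqw projK.
  by rewrite -eqw /proj opprB addrC subrK; exists (gm *m s).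
have [N0 [w0 [w0K w0I]]] := step (inord 0).
have [N1 [w1 [w1K w1I]]] := step (inord 1).
have [N2 [w2 [w2K w2I]]] := step (inord 2).
set h0 := 'X_(inord 0) ^+ N0 in w0I; set h1 := 'X_(inord 1) ^+ N1 in w1I.
set h2 := 'X_(inord 2) ^+ N2 in w2I.
have cmp (hi hj : S) (wi wj : 'cV_nb) : in_image (hi *: s - p *: wi) ->
    in_image (hj *: s - p *: wj) -> in_image (hj *: wi - hi *: wj).
  move=> iI jI; apply: (in_image_torsion_free p0).
  have -> : p *: (hj *: wi - hi *: wj) =
      hi *: (hj *: s - p *: wj) - hj *: (hi *: s - p *: wi).
    rewrite !scalerBr !scalerA ![p * _]mulrC [hj * hi]mulrC.
    by rewrite opprB [RHS]addrC addrA subrK.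
  by apply: in_imageB; apply: in_imageZ.
have [c01 e01] := cmp _ _ _ _ w0I w1I.
have [c02 e02] := cmp _ _ _ _ w0I w2I.
have [c12 e12] := cmp _ _ _ _ w1I w2I.
(* The cocycle condition; Koszul exactness then writes c01 as a coboundary. *)
have eqk : h2 *: c01 = h1 *: c02 - h0 *: c12.
  apply: beta_inj; rewrite mulmxBr -!scalemxAr -e01 -e02 -e12.
  rewrite !scalerBr !scalerA [h1 * h2]mulrC [h0 * h2]mulrC [h0 * h1]mulrC.
  by rewrite opprB addrA subrK.
have [|||d1 [d0 ed]] := @koszul_exact_col k 4 nc (inord 1) (inord 0) (inord 2)
  N1 N0 N2 c01 c02 (- c12).
- by rewrite -val_eqE /= !inordK.
- by rewrite -val_eqE /= !inordK.
- by rewrite -/h0 -/h1 -/h2 eqk scalerN.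
rewrite -/h0 -/h1 in ed.
have [||w ew] := @varX_coprime k 4 nb (inord 0) (inord 1) N0 N1
    (w1 + beta *m d0) (w0 - beta *m d1).
- by rewrite -val_eqE /= !inordK.
- move: e01; rewrite ed mulmxDr -!scalemxAr => /eqP; rewrite subr_eq => /eqP e01.
  by rewrite -/h0 -/h1 scalerBr scalerDr e01 addrC !addrA addNr add0r addrC.
rewrite -/h0 in ew.
have h00 : h0 != 0 by apply: varX_neq0.
exists w.
  apply: (scalemx_cancel h00); rewrite scaler0 scalemxAr -ew mulmxBr w0K mulmxA ab0.
  by rewrite mul0mx subr0.
apply: (in_image_torsion_free h00); rewrite scalerBr scalerA mulrC -scalerA -ew.
rewrite scalerBr opprB addrCA; apply: in_imageD => //.
by apply: in_imageZ; exists d1.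
Qed.

End Torsion.

(** * Homogeneous components *)

Section Components.
Variable k : fieldType.
Local Notation S := {mpoly k[4]}.
Implicit Types (f g : S) (d e t : int) (b : seq int).

Definition hpart d f : S := if d is Posz n then pihomog mdeg n f else 0.

Lemma mcoeff_hpart d f m :
  (hpart d f)@_m = if (mdeg m)%:Z == d then f@_m else 0.
Proof.
case: d => [n|n] /=; last by rewrite mcoeff0.
rewrite pihomogE raddf_sum /= eqz_nat.
case: eqP => [<-|ne].
  rewrite [in RHS](mpolyE f) raddf_sum /= big_mkcond; apply: eq_bigr => m' _ /=.
  case: eqP => // ne; rewrite mcoeffZ mcoeffX.
  by case: eqP ne => [->|]; rewrite ?mulr0.
apply: big1 => m' /eqP eqm; rewrite mcoeffZ mcoeffX.
by case: eqP eqm => [->|]; rewrite ?mulr0.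
Qed.

Lemma of_degreeP d f :
  reflect (forall m, f@_m != 0 -> (mdeg m)%:Z = d) (of_degree d f).
Proof.
case: d => n /=.
  apply: (iffP idP) => [/dhomogP fP m|fP].
    by rewrite -mcoeff_msupp => /fP /= ->.
  by apply/dhomogP => m; rewrite mcoeff_msupp => /fP [].
apply: (iffP eqP) => [-> m|fP]; first by rewrite mcoeff0 eqxx.
apply/mpolyP => m; rewrite mcoeff0; apply/eqP; apply: contraT => /fP.
by [].
Qed.

Lemma of_degree_hpart d f : of_degree d (hpart d f).
Proof.
apply/of_degreeP => m; rewrite mcoeff_hpart.
by case: (_ =P d) => [->|_] //; rewrite eqxx.
Qed.

Lemma hpart_id d f : of_degree d f -> hpart d f = f.
Proof.
move/of_degreeP => fP; apply/mpolyP => m; rewrite mcoeff_hpart.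
case: eqP => // ne; apply/esym/eqP; apply: contraT => /fP //.
Qed.

Lemma hpart_ne d e f : of_degree d f -> d != e -> hpart e f = 0.
Proof.
move/of_degreeP => fP ne; apply/mpolyP => m; rewrite mcoeff_hpart mcoeff0.
case: eqP => // eqe; apply/eqP; apply: contraNT ne => /fP <-.
by rewrite eqe.
Qed.

Lemma hpartD d : {morph hpart d : f g / f + g}.
Proof.
move=> f g; apply/mpolyP => m; rewrite mcoeffD !mcoeff_hpart mcoeffD.
by case: eqP; rewrite ?addr0.
Qed.

Lemma hpart0 d : hpart d 0 = 0.
Proof. by apply/mpolyP => m; rewrite mcoeff_hpart mcoeff0 if_same. Qed.

Lemma hpart_sum d I (r : seq I) (P : pred I) (F : I -> S) :
  hpart d (\sum_(i <- r | P i) F i) = \sum_(i <- r | P i) hpart d (F i).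
Proof. exact: (big_morph _ (hpartD d) (hpart0 d)). Qed.

Lemma of_degree0 d : of_degree d (0 : S).
Proof. by apply/of_degreeP => m; rewrite mcoeff0 eqxx. Qed.

Lemma of_degreeM d e f g :
  of_degree d f -> of_degree e g -> of_degree (d + e) (f * g).
Proof.
case: d => [n|n]; last by move=> /eqP -> _; rewrite mul0r of_degree0.
case: e => [m|m]; last by move=> _ /eqP ->; rewrite mulr0 of_degree0.
exact: dhomogM.
Qed.

Lemma of_degreeC (c : k) : of_degree 0 (c%:MP : S).
Proof.
apply/of_degreeP => m; rewrite mcoeffC.
case: (m =P 0%MM) => [->|]; first by rewrite mdeg0.
by rewrite mulr0 eqxx.
Qed.

(** The degrees F j = j - N start below 0, where the components vanish, so that the
entries of a column, whose degrees are shifted differently, can be decomposed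
over a common range. *)
Lemma hpart_decomp N (F : int -> int) : (forall d, F d = d - N%:Z) -> forall f M,
  (msize f + N <= M)%N -> f = \sum_(j < M) hpart (F j) f.
Proof.
move=> FP f M le_M; apply/mpolyP => m; rewrite raddf_sum /=.
have [f0|] := eqVneq f@_m 0.
  by rewrite f0 big1 // => j _; rewrite mcoeff_hpart f0 if_same.
rewrite -mcoeff_msupp => mf; have mM := msize_mdeg_lt mf.
have jM : (mdeg m + N < M)%N by lia.
rewrite (bigD1 (Ordinal jM)) //= mcoeff_hpart FP PoszD addrK eqxx.
rewrite big1 ?addr0 // => j /eqP jn; rewrite mcoeff_hpart FP.
by case: eqP => // eqj; case: jn; apply: val_inj => /=; lia.
Qed.

Lemma hpart_mulr d e f g : of_degree d f -> hpart e (f * g) = f * hpart (e - d) g.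
Proof.
move=> fd.
have eqg : g = \sum_(j < msize g) hpart j g.
  by apply: (hpart_decomp (N := 0) (F := id)); rewrite ?addn0 // => ?; rewrite subr0.
rewrite [in LHS]eqg mulr_sumr hpart_sum [in RHS]eqg.
rewrite hpart_sum mulr_sumr; apply: eq_bigr => j _.
have fgd := of_degreeM fd (of_degree_hpart j g).
have [eqe|ne] := eqVneq (d + j%:Z) e.
  have -> : e - d = j%:Z by lia.
  by rewrite (hpart_id (of_degree_hpart j g)) hpart_id // -eqe.
rewrite (hpart_ne fgd ne) (hpart_ne (of_degree_hpart _ _)) ?mulr0 //.
by apply: contraNneq ne => ->; apply/eqP; lia.
Qed.

Lemma hpart_mull d e f g : of_degree d g -> hpart e (f * g) = hpart (e - d) f * g.
Proof. by move=> gd; rewrite mulrC (hpart_mulr _ _ gd) mulrC. Qed.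

Definition hpartv b t (v : 'cV[S]_(size b)) : 'cV[S]_(size b) :=
  \col_i hpart (b`_i + t) (v i 0).

Lemma in_pieceP b t (v : 'cV[S]_(size b)) :
  in_piece t v <-> forall i : 'I_(size b), of_degree (b`_i + t) (v i 0).
Proof.
split=> [vP i|vP i j]; first by have := vP i 0; rewrite subr0.
by rewrite !ord1 subr0.
Qed.

Lemma in_piece_hpartv b t (v : 'cV[S]_(size b)) : in_piece t (hpartv t v).
Proof. by apply/in_pieceP => i; rewrite mxE of_degree_hpart. Qed.

Lemma hpartv_id b t (v : 'cV[S]_(size b)) : in_piece t v -> hpartv t v = v.
Proof.
by move/in_pieceP => vP; apply/colP => i; rewrite mxE hpart_id.
Qed.

Lemma hpartv_ne b t e (v : 'cV[S]_(size b)) :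
  in_piece t v -> t != e -> hpartv e v = 0.
Proof.
move/in_pieceP => vP ne; apply/colP => i; rewrite !mxE (hpart_ne (vP i)) //.
by apply: contraNneq ne => /addrI ->.
Qed.

Lemma hpartvD b t : {morph @hpartv b t : u v / u + v}.
Proof. by move=> u v; apply/colP => i; rewrite !mxE hpartD. Qed.

Lemma hpartv0 b t : @hpartv b t 0 = 0.
Proof. by apply/colP => i; rewrite !mxE hpart0. Qed.

Lemma hpartvB b t : {morph @hpartv b t : u v / u - v}.
Proof.
by move=> u v; apply: (addIr (hpartv t v)); rewrite -hpartvD !subrK.
Qed.

Lemma hpartv_sum b t I (r : seq I) (P : pred I) (F : I -> 'cV[S]_(size b)) :
  hpartv t (\sum_(i <- r | P i) F i) = \sum_(i <- r | P i) hpartv t (F i).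
Proof. exact: (big_morph _ (@hpartvD b t) (hpartv0 b t)). Qed.

Lemma in_piece0 b t : in_piece t (0 : 'cV[S]_(size b)).
Proof. by apply/in_pieceP => i; rewrite mxE of_degree0. Qed.

Lemma in_pieceD b t (u v : 'cV[S]_(size b)) :
  in_piece t u -> in_piece t v -> in_piece t (u + v).
Proof.
move=> /hpartv_id <- /hpartv_id <-; rewrite -hpartvD.
exact: in_piece_hpartv.
Qed.

Lemma in_pieceB b t (u v : 'cV[S]_(size b)) :
  in_piece t u -> in_piece t v -> in_piece t (u - v).
Proof.
move=> /hpartv_id <- /hpartv_id <-; rewrite -hpartvB.
exact: in_piece_hpartv.
Qed.

Lemma in_pieceZ b t d f (v : 'cV[S]_(size b)) :
  of_degree d f -> in_piece t v -> in_piece (t + d) (f *: v).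
Proof.
move=> fd /in_pieceP vP; apply/in_pieceP => i; rewrite mxE.
have -> : b`_i + (t + d) = d + (b`_i + t) by lia.
exact: of_degreeM.
Qed.

Lemma hpartvZl b t d f (v : 'cV[S]_(size b)) :
  of_degree d f -> hpartv t (f *: v) = f *: hpartv (t - d) v.
Proof.
by move=> fd; apply/colP => i; rewrite !mxE (hpart_mulr _ _ fd) addrA.
Qed.

Lemma hpartvZr b t s f (v : 'cV[S]_(size b)) :
  in_piece s v -> hpartv t (f *: v) = hpart (t - s) f *: v.
Proof.
move=> /in_pieceP vP; apply/colP => i; rewrite !mxE (hpart_mull _ _ (vP i)).
by congr (hpart _ _ * _); lia.
Qed.

Lemma hpartv_mulmx b c t (phi : 'M[S]_(size c, size b)) (v : 'cV[S]_(size b)) :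
  is_hom 0 phi -> hpartv t (phi *m v) = phi *m hpartv t v.
Proof.
move=> phiP; apply/colP => i; rewrite !mxE hpart_sum; apply: eq_bigr => j _.
rewrite mxE (hpart_mulr _ _ (phiP i j)); congr (_ * hpart _ _); lia.
Qed.

Lemma in_piece_mulmx b c t (phi : 'M[S]_(size c, size b)) (v : 'cV[S]_(size b)) :
  is_hom 0 phi -> in_piece t v -> in_piece t (phi *m v).
Proof.
by move=> phiP /hpartv_id <-; rewrite -hpartv_mulmx //; apply: in_piece_hpartv.
Qed.

Lemma hpartv_decomp b (v : 'cV[S]_(size b)) : exists N M : nat,
  v = \sum_(j < M) hpartv (j%:Z - N%:Z) v /\
  forall t, M%:Z - N%:Z <= t -> hpartv t v = 0.
Proof.
pose ab (i : 'I_(size b)) : nat := `|(b`_i)%R|%N.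
pose B := (\max_(i < size b) ab i)%N.
pose D := (\max_(i < size b) msize (v i 0%R))%N.
have leB i : (ab i <= B)%N by apply: (@leq_bigmax _ ab).
have leD i : (msize (v i 0%R) <= D)%N.
  exact: (@leq_bigmax _ (fun i : 'I_(size b) => msize (v i 0%R))).
exists B, (D + B + B)%N; split.
  apply/colP => i; rewrite summxE.
  have := leB i; have := leD i; rewrite /ab => lD lB.
  rewrite [LHS](@hpart_decomp `|(B%:Z - b`_i)%R|%N
    (fun d => b`_i + (d - B%:Z)) _ _ (D + B + B)%N).
  - by apply: eq_bigr => j _; rewrite mxE.
  - by move=> d; lia.
  - by lia.
move=> t le_t; apply/colP => i; rewrite !mxE.
have := leB i; have := leD i; rewrite /ab => lD lB.
apply/mpolyP => m; rewrite mcoeff_hpart mcoeff0; case: eqP => // eqm.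
apply/eqP; rewrite mcoeff_eq0; apply/negP => /msize_mdeg_lt; lia.
Qed.

End Components.

(** * Saturated submodules of rank one *)

Lemma exists_least (P : nat -> Prop) :
  (exists n, P n) -> exists2 n, P n & forall m, (m < n)%N -> ~ P m.
Proof.
case=> n; have [m] := ubnP n; elim: m n => // m IHm n nm Pn.
have [[i [im Pi]]|noi] := classic (exists i, (i < n)%N /\ P i).
  by apply: (IHm i) => //; lia.
by exists n => // i im Pi; apply: noi; exists i.
Qed.

(** Reversing the order of the interval turns this into the existence of a least
element. *)
Lemma exists_last (P : nat -> Prop) M : (exists2 n, (n < M)%N & P n) ->
  exists2 n, P n & forall m, (n < m < M)%N -> ~ P m.
Proof.
case=> n nM Pn.
have [|j [jM Pj] jmin] := @exists_least (fun j => (j < M)%N /\ P (M.-1 - j)%N).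
  by exists (M.-1 - n)%N; split; [lia | rewrite (_ : (_ - _)%N = n) //; lia].
exists (M.-1 - j)%N => // m mM Pm; apply: (jmin (M.-1 - m)%N); first by lia.
by split; [lia | rewrite (_ : (_ - _)%N = m) //; lia].
Qed.

Section RankOne.
Variables (k : fieldType) (c b a : seq int).
Local Notation S := {mpoly k[4]}.
Variables (beta : 'M[S]_(size b, size c)) (alpha : 'M[S]_(size a, size b)).
Hypotheses (betaP : is_hom 0 beta) (alphaP : is_hom 0 alpha).
Hypothesis ab0 : alpha *m beta = 0.
Hypothesis gammaP : forall i : 'I_4, exists N (gamma : 'M[S]_(size c, size b)),
  gamma *m beta = ('X_i ^+ N)%:M.
Hypothesis no_section :
  forall v : 'cV[S]_(size b), in_piece 0 v -> alpha *m v = 0 -> v = 0.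
Implicit Types (u v w s : 'cV[S]_(size b)) (f g p : S) (t d e : int).
Local Notation inI := (in_image beta).

Lemma in_image_hpartv t v : inI v -> inI (hpartv t v).
Proof. by case=> u ->; rewrite hpartv_mulmx //; exists (hpartv t u). Qed.

Lemma kernel_hpartv t v : alpha *m v = 0 -> alpha *m hpartv t v = 0.
Proof. by move=> vK; rewrite -hpartv_mulmx // vK hpartv0. Qed.

Lemma of_degree_varX (i : 'I_4) n : of_degree n%:Z ('X_i ^+ n : S).
Proof. by rewrite /= mpolyXn dhomogX /= mdegMn mdeg1 mul1n. Qed.

(** A section in negative degree times a power of a variable is a section in
degree 0. *)
Lemma kernel_nonpos t v : t <= 0 -> in_piece t v -> alpha *m v = 0 -> v = 0.
Proof.
move=> t0 vt vK; apply: (scalemx_cancel (varX_neq0 _ 0 `|t|)).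
rewrite scaler0; apply: no_section; last by rewrite -scalemxAr vK scaler0.
have := in_pieceZ (of_degree_varX 0 `|t|) vt.
by rewrite (_ : _ + _ = 0) //; lia.
Qed.

(** I is graded, so an element outside I has a component outside I; there are
finitely many of them. *)
Lemma top_component w : ~ inI w ->
  exists2 j, ~ inI (hpartv j w) & forall i, j < i -> inI (hpartv i w).
Proof.
move=> nwI; have [N [M [eqw topw]]] := hpartv_decomp w.
have [|n nP nmax] := @exists_last (fun j => ~ inI (hpartv (j%:Z - N%:Z) w)) M.
  apply: NNPP => noj; apply: nwI; rewrite eqw; apply: in_image_sum => j _.
  by apply: NNPP => jI; apply: noj; exists j.
exists (n%:Z - N%:Z) => // i ni; have [iM|iM] := ltP i (M%:Z - N%:Z); last first.
  by rewrite topw //; apply: in_image0.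
have -> : i = `|(i + N%:Z)%R|%N%:Z - N%:Z by lia.
by apply: NNPP; apply: nmax; lia.
Qed.

Lemma top_coefficient p : p != 0 ->
  exists2 n, hpart n%:Z p != 0 & p = \sum_(i < n.+1) hpart i%:Z p.
Proof.
move=> p0; exists (mdeg (mlead p)).
  apply: contraNneq p0 => /(congr1 (fun f : S => f@_(mlead p))).
  by rewrite mcoeff_hpart eqxx mcoeff0 => /eqP; rewrite mleadc_eq0.
by apply: (hpart_decomp (N := 0) (F := id)) => [d|]; rewrite ?subr0 // addn0 mlead_deg.
Qed.

(** A prime is not constant, hence has positive degree. *)
Lemma prime_top p : prime_elt p ->
  exists2 n, (0 < n)%N & hpart n%:Z p != 0 /\ p = \sum_(i < n.+1) hpart i%:Z p.
Proof.
case=> p0 pu _; have [n pn eqp] := top_coefficient p0; exists n => //.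
case: n => // in pn eqp *; case/negP: pu; rewrite eqp big_ord1.
have -> : hpart 0 p = (p@_0)%:MP.
  apply/mpolyP => m; rewrite mcoeff_hpart mcoeffC eqz_nat mdeg_eq0.
  by rewrite eq_sym; case: eqP => [->|]; rewrite ?mulr1 ?mulr0.
rewrite rmorph_unit // unitfE; apply: contraNneq pn => p00.
apply/eqP/mpolyP => m; rewrite mcoeff_hpart mcoeff0 eqz_nat mdeg_eq0.
by case: eqP => [->|].
Qed.

Definition dependent s0 v := exists f g, f != 0 /\ inI (f *: v - g *: s0).

(** Take s of least degree among the homogeneous elements outside I that depend on
s0.  For any other v depending on s0, there is a relation F v = G s modulo I,
and each prime p of F can be cancelled: otherwise p does not divide G, so that
s = p w modulo I by [prime_in_image], and the top component of w is a dependent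
element of degree less than s. *)
Lemma rank_one_generator d0 s0 :
  in_piece d0 s0 -> alpha *m s0 = 0 -> ~ inI s0 ->
  exists e s, [/\ 0 < e, in_piece e s, alpha *m s = 0, ~ inI s
    & forall t v, in_piece t v -> alpha *m v = 0 -> dependent s0 v ->
        exists2 f, of_degree (t - e) f & inI (v - f *: s)].
Proof.
move=> s0d s0K s0I.
pose P (n : nat) := exists s, [/\ in_piece n%:Z s, alpha *m s = 0, ~ inI s
  & dependent s0 s].
have posd t v : in_piece t v -> alpha *m v = 0 -> ~ inI v -> 0 < t.
  move=> vt vK vI; rewrite ltNge; apply/negP => t0; apply: vI.
  by rewrite (kernel_nonpos t0 vt vK); apply: in_image0.
have [|n [s [sn sK sI [f' [g' [f'0 s_s0]]]]] nmin] := @exists_least P.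
  have d0P := posd _ _ s0d s0K s0I; exists `|d0|%N, s0; split=> //.
    by rewrite gtz0_abs.
  by exists 1, 1; rewrite oner_neq0 subrr; split=> //; apply: in_image0.
exists n%:Z, s; split=> //; first exact: posd sn sK sI.
have g'0 : g' != 0.
  apply: contra_notN sI => /eqP g'0; apply: (in_image_torsion_free gammaP f'0).
  by rewrite g'0 scale0r subr0 in s_s0.
(* By minimality of its degree, s is not divisible by any prime modulo I. *)
have sprim p w : prime_elt p -> alpha *m w = 0 -> ~ inI (s - p *: w).
  move=> pP wK spw; have [p0 _ _] := pP.
  have nwI : ~ inI w.
    move=> wI; apply: sI; rewrite -(subrK (p *: w) s).
    by apply: in_imageD; last apply: in_imageZ.
  have [j wjI wtop] := top_component nwI.
  have [m m0 [pm0 eqp]] := prime_top pP.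
  have step : inI (hpartv (m%:Z + j) s - hpart m p *: hpartv j w).
    have : inI (hpartv (m%:Z + j) (s - p *: w)) by apply: in_image_hpartv.
    rewrite hpartvB [in X in X -> _]eqp scaler_suml hpartv_sum big_ord_recr /=.
    rewrite (hpartvZl _ _ (of_degree_hpart m p)) [_ + j - _]addrAC subrr add0r opprD.
    rewrite addrCA => stepI.
    set x := \sum_(i < m) _ in stepI; have xI : inI x.
      apply: in_image_sum => i _; rewrite (hpartvZl _ _ (of_degree_hpart i p)).
      by apply/in_imageZ/wtop; have := ltn_ord i; lia.
    by have := in_imageD xI stepI; rewrite addKr || rewrite addNKr.
  have [eqn|ne] := eqVneq n%:Z (m%:Z + j); last first.
    apply: wjI; apply: (in_image_torsion_free gammaP pm0).
    by move: step; rewrite (hpartv_ne sn ne) sub0r => /in_imageN; rewrite opprK.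
  rewrite -eqn hpartv_id // in step.
  have wjK := kernel_hpartv j wK.
  have j0 := posd _ _ (in_piece_hpartv j w) wjK wjI.
  refine (nmin `|j|%N _ _); first by lia.
  exists (hpartv j w); split=> //; first by rewrite gtz0_abs //; apply: in_piece_hpartv.
  exists (f' * hpart m p), g'; split; first by rewrite mulf_neq0.
  have := in_imageB s_s0 (in_imageZ f' step).
  by rewrite scalerBr scalerA opprB addrC addrA subrK.
have reduce l F G v : prime_product l F -> alpha *m v = 0 ->
    inI (F *: v - G *: s) -> exists f, inI (v - f *: s).
  elim: l F G v => [|p l IHl] F G v.
    case=> _ [u uu]; rewrite big_nil mulr1 => -> _ vI.
    exists (u^-1 * G); have := in_imageZ u^-1 vI.
    by rewrite scalerBr !scalerA (mulVr uu) scale1r.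
  case/prime_product_cons=> pP [B -> lB] vK vI; have [p0 _ _] := pP.
  have [[G' eqG]|npG] := classic (divides p G).
    apply: (IHl B G' v lB vK); apply: (in_image_torsion_free gammaP p0).
    by rewrite scalerBr !scalerA -eqG.
  have [||w wK /(sprim _ _ pP wK)//] :=
      @prime_in_image k _ _ _ beta alpha ab0 gammaP p G s (B *: v) pP npG sK.
  - by rewrite -scalemxAr vK scaler0.
  - by have := in_imageN vI; rewrite opprB scalerA.
move=> t v vt vK [f [g [f0 vI]]].
have [l lF] := @factorial_mpoly k 4 (g' * f) (mulf_neq0 g'0 f0).
have [|h hI] := reduce l (g' * f) (g * f') v lF vK.
  have := in_imageB (in_imageZ g' vI) (in_imageZ g s_s0).
  rewrite !scalerBr !scalerA [g * g']mulrC opprB addrA subrK //.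
exists (hpart (t - n%:Z) h); first exact: of_degree_hpart.
by have := in_image_hpartv t hI; rewrite hpartvB (hpartv_id vt) (hpartvZr _ _ sn).
Qed.

End RankOne.

(** * Monomial bases and the exchange lemma *)

Section Steinitz.
Variables (k : fieldType) (r : nat).
Local Notation S := {mpoly k[4]}.
Local Notation V := 'cV[S]_r.
Variable Q : V -> Prop.
Hypothesis Q0 : Q 0.
Hypothesis QD : forall u v, Q u -> Q v -> Q (u + v).
Hypothesis QZ : forall (c : k) v, Q v -> Q (c%:MP *: v).

Definition spanned_mod (J : finType) (f : J -> V) (v : V) :=
  exists z : J -> k, Q (v - \sum_j (z j)%:MP *: f j).

Definition independent_mod (I : finType) (e : I -> V) :=
  forall z : I -> k, Q (\sum_i (z i)%:MP *: e i) -> forall i, z i = 0.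

(** The exchange lemma modulo the subspace Q: if the e i outnumber the f j, then
the matrix of coefficients of the e i has a nonzero left kernel, which is a
linear relation between the e i modulo Q. *)
Lemma steinitz_mod (I J : finType) (e : I -> V) (f : J -> V) :
  (forall i, spanned_mod f (e i)) -> independent_mod e -> (#|I| <= #|J|)%N.
Proof.
move=> /fin_all_exists[z zP] ind.
rewrite leqNgt; apply/negP => JI.
pose A := \matrix_(i < #|I|, j < #|J|) z (enum_val i) (enum_val j).
have : kermx A != 0.
  by rewrite -mxrank_eq0 mxrank_ker subn_eq0 -ltnNge (leq_ltn_trans (rank_leq_col A)).
case/rowV0Pn => y /sub_kermxP yA /eqP; apply.
have yz j : \sum_i y 0 (enum_rank i) * z i j = 0.
  have /matrixP/(_ 0 (enum_rank j)) := yA; rewrite !mxE => yAj; rewrite -[RHS]yAj.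
  rewrite (reindex _ (onW_bij _ (enum_val_bij I))) /=.
  by apply: eq_bigr => i _; rewrite mxE enum_valK enum_rankK.
have : Q (\sum_i (y 0 (enum_rank i))%:MP *: e i).
  suff <- : \sum_i (y 0 (enum_rank i))%:MP *:
      (e i - \sum_j (z i j)%:MP *: f j) = \sum_i (y 0 (enum_rank i))%:MP *: e i.
    by apply: (big_ind Q Q0 QD) => i _; apply: QZ.
  rewrite (eq_bigr _ (fun i _ => scalerBr _ _ _)) sumrB.
  rewrite [X in _ - X](_ : _ = 0) ?subr0 //.
  rewrite (eq_bigr _ (fun i _ => scaler_sumr _ _ _ _)) exchange_big big1 // => j _.
  rewrite (eq_bigr (fun i => (y 0 (enum_rank i) * z i j)%:MP *: f j)).
    by rewrite -scaler_suml -raddf_sum yz raddf0 scale0r.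
  by move=> i _; rewrite scalerA mpolyCM.
by move/ind => y0; apply/rowP => i; rewrite -(enum_valK i) y0 mxE.
Qed.

End Steinitz.

Section MonomialBasis.
Variable k : fieldType.
Local Notation S := {mpoly k[4]}.
Implicit Types (f : S) (d t : int) (b : seq int).

Definition monomials d : seq 'X_{1..4} :=
  if d is Posz n then [seq s2m t | t : n.-tuple 'I_4 <- enum (basis 4 n)]
  else [::].

Definition hdim d : nat := if d is Posz n then 'C(n + 3, 3) else 0.

Lemma size_monomials d : size (monomials d) = hdim d.
Proof.
by case: d => [n|] //=; rewrite size_basis -(bin_sub (leq_addr 3 n)) addKn.
Qed.

Lemma monomials_uniq d : uniq (monomials d).
Proof. by case: d => [n|] //=; apply: uniq_basis. Qed.

Lemma mem_monomials d m : (m \in monomials d) = ((mdeg m)%:Z == d).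
Proof. by case: d => [n|n] //=; rewrite -basis_cover eqz_nat. Qed.

Lemma of_degree_monomial d m : m \in monomials d -> of_degree d ('X_[m] : S).
Proof.
rewrite mem_monomials => /eqP md; apply/of_degreeP => m'; rewrite mcoeffX.
by have [<-|_] := eqVneq m m'; rewrite ?eqxx.
Qed.

Lemma monomial_expansion d f : of_degree d f ->
  f = \sum_(m <- monomials d) (f@_m)%:MP * 'X_[m].
Proof.
move/of_degreeP => fP; apply/mpolyP => m; rewrite raddf_sum /=.
have [f0|/fP/eqP] := eqVneq f@_m 0; last rewrite -mem_monomials => mm.
  rewrite f0 big1 // => m' _; rewrite mcoeffCM mcoeffX.
  by case: eqP => [->|]; rewrite ?f0 ?mul0r ?mulr0.
rewrite (bigD1_seq m) ?monomials_uniq //= mcoeffCM mcoeffX eqxx mulr1.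
rewrite big1 ?addr0 // => m' /negbTE ne.
by rewrite mcoeffCM mcoeffX ne mulr0.
Qed.

Definition monomial d (i : 'I_(size (monomials d))) : S :=
  'X_[tnth (in_tuple (monomials d)) i].

Lemma monomial_degree d i : of_degree d (@monomial d i).
Proof. by apply: of_degree_monomial; apply: mem_tnth. Qed.

Lemma monomial_span d f : of_degree d f ->
  exists z, f = \sum_(i < size (monomials d)) (z i)%:MP * monomial i.
Proof.
move=> fd; exists (fun i => f@_(tnth (in_tuple (monomials d)) i)).
rewrite {1}(monomial_expansion fd).
by rewrite -(big_tuple _ _ (in_tuple (monomials d)) xpredT
  (fun m => (f@_m)%:MP * 'X_[m])).
Qed.

Lemma monomial_free d (z : 'I_(size (monomials d)) -> k) :
  \sum_i (z i)%:MP * monomial i = 0 -> forall i, z i = 0.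
Proof.
move=> z0 i.
have := congr1 (mcoeff (tnth (in_tuple (monomials d)) i)) z0.
rewrite raddf_sum mcoeff0 (bigD1 i) //= mcoeffCM mcoeffX eqxx mulr1.
rewrite big1 ?addr0 // => j ji; rewrite mcoeffCM mcoeffX.
have at_inj := tuple_uniqP (in_tuple (monomials d)) (monomials_uniq d).
by rewrite (inj_eq at_inj) (negbTE ji) mulr0.
Qed.

(** The monomial basis of B(t): the monomial m placed in the entry i. *)
Definition piece_index b t : seq ('I_(size b) * 'X_{1..4}) :=
  [seq (i, m) | i : 'I_(size b) <- enum 'I_(size b),
                m : 'X_{1..4} <- monomials (b`_i + t)].

Definition piece_dim b t : nat := \sum_(x <- b) hdim (x + t).

Lemma size_piece_index b t : size (piece_index b t) = piece_dim b t.
Proof.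
rewrite size_allpairs_dep sumnE big_map big_enum /=.
rewrite /piece_dim (big_nth 0) big_mkord.
by apply: eq_bigr => i _; rewrite size_monomials.
Qed.

Lemma piece_index_uniq b t : uniq (piece_index b t).
Proof.
apply: allpairs_uniq_dep; first exact: enum_uniq.
  by move=> i _; apply: monomials_uniq.
by move=> [i m] [j m'] _ _ /= [-> ->].
Qed.

Lemma mem_piece_index b t i m :
  ((i, m) \in piece_index b t) = ((mdeg m)%:Z == b`_i + t).
Proof.
apply/allpairsPdep/idP => [[j [m' [_ jm [-> ->]]]]|im].
  by rewrite -mem_monomials.
by exists i, m; rewrite mem_enum mem_monomials.
Qed.

Local Notation idx b t := 'I_(size (piece_index b t)).
Local Notation at_ j := (tnth (in_tuple (piece_index _ _)) j).

Definition basis_vec b t (j : idx b t) : 'cV[S]_(size b) :=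
  'X_[(at_ j).2] *: delta_mx (at_ j).1 0.

Definition coord b t (v : 'cV[S]_(size b)) : 'rV[k]_(size (piece_index b t)) :=
  \row_j (v (at_ j).1 0)@_((at_ j).2).

Definition vec_of b t (z : 'rV[k]_(size (piece_index b t))) : 'cV[S]_(size b) :=
  \sum_j (z 0 j)%:MP *: basis_vec j.

Lemma in_piece_basis_vec b t (j : idx b t) : in_piece t (basis_vec j).
Proof.
apply/in_pieceP => i; rewrite !mxE eqxx andbT.
have := mem_tnth j (in_tuple (piece_index b t)).
case: (tnth _ j) => i' m /=; rewrite mem_piece_index -mem_monomials => mP.
by case: eqP => [->|_]; rewrite ?mulr1 ?mulr0 ?of_degree0 ?of_degree_monomial.
Qed.

Lemma in_piece_sum b t I (s : seq I) (P : pred I) (F : I -> 'cV[S]_(size b)) :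
  (forall i, P i -> in_piece t (F i)) -> in_piece t (\sum_(i <- s | P i) F i).
Proof.
by move=> FP; apply: big_ind => //; [apply: in_piece0 | apply: in_pieceD].
Qed.

Lemma in_pieceC b t (c : k) (v : 'cV[S]_(size b)) :
  in_piece t v -> in_piece t (c%:MP *: v).
Proof. by move=> /(in_pieceZ (of_degreeC c)); rewrite addr0. Qed.

Lemma in_piece_vec_of b t (z : 'rV_(size (piece_index b t))) :
  in_piece t (vec_of z).
Proof.
by apply: in_piece_sum => j _; apply: in_pieceC; apply: in_piece_basis_vec.
Qed.

Lemma mcoeff_basis_vec b t (z : k) (j : idx b t) i m :
  ((z%:MP *: basis_vec j) i 0)@_m = if at_ j == (i, m) then z else 0.
Proof.
rewrite mxE mcoeffCM /basis_vec; case: (tnth _ j) => i' m' /=.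
rewrite mxE mxE eqxx andbT xpair_eqE [i == i']eq_sym.
case: (i' == i) => /=; last by rewrite mulr0 mcoeff0 mulr0.
by rewrite mulr1 mcoeffX; case: (m' == m); rewrite ?mulr1 ?mulr0.
Qed.

Lemma mcoeff_vec_of b t (z : 'rV_(size (piece_index b t))) (j : idx b t) :
  (vec_of z (at_ j).1 0)@_((at_ j).2) = z 0 j.
Proof.
have at_inj := tuple_uniqP (in_tuple (piece_index b t)) (piece_index_uniq b t).
rewrite summxE raddf_sum /= (bigD1 j isT) /= [X in X + _]mcoeff_basis_vec.
rewrite -surjective_pairing eqxx.
rewrite big1 ?addr0 // => l lj.
by rewrite mcoeff_basis_vec -surjective_pairing (inj_eq at_inj) (negbTE lj).
Qed.

Lemma vec_ofK b t : cancel (@vec_of b t) (coord t).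
Proof. by move=> z; apply/rowP => j; rewrite mxE mcoeff_vec_of. Qed.

Lemma coordK b t (v : 'cV[S]_(size b)) : in_piece t v -> vec_of (coord t v) = v.
Proof.
move=> vt; apply/colP => i; apply/mpolyP => m.
have [/tnthP[j eqj]|vm] := boolP ((i, m) \in in_tuple (piece_index b t)).
  by have := mcoeff_vec_of (coord t v) j; rewrite mxE -eqj.
have -> : (v i 0)@_m = 0.
  apply/eqP; apply: contraNT vm => vm0; rewrite mem_piece_index.
  by move/in_pieceP: vt => /(_ i)/of_degreeP/(_ _ vm0) ->.
rewrite summxE raddf_sum big1 // => l _ /=; rewrite mcoeff_basis_vec ifN //.
by apply: contraNneq vm => <-; apply: mem_tnth.
Qed.

Lemma vec_of_mul b t n (z : 'rV[k]_n) (M : 'M_(n, size (piece_index b t))) :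
  vec_of (z *m M) = \sum_i (z 0 i)%:MP *: vec_of (row i M).
Proof.
rewrite /vec_of (eq_bigr _ (fun i _ => scaler_sumr _ _ _ _)) exchange_big /=.
apply: eq_bigr => j _; rewrite mxE raddf_sum scaler_suml.
by apply: eq_bigr => i _ /=; rewrite mxE scalerA -mpolyCM.
Qed.

Definition piece_mx b c t (phi : 'M[S]_(size c, size b)) :
    'M[k]_(size (piece_index b t), size (piece_index c t)) :=
  \matrix_j coord t (phi *m basis_vec j).

Lemma mulmx_vec_of b c t (phi : 'M[S]_(size c, size b)) z :
  is_hom 0 phi -> phi *m vec_of z = vec_of (z *m piece_mx t phi).
Proof.
move=> phiP; rewrite vec_of_mul mulmx_sumr; apply: eq_bigr => j _.
rewrite rowK -scalemxAr coordK //.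
exact: in_piece_mulmx (in_piece_basis_vec j).
Qed.

End MonomialBasis.

(** * Hilbert polynomials *)

Section Cohomology.
Variables (k : fieldType) (c b a : seq int).
Local Notation S := {mpoly k[4]}.
Variables (beta : 'M[S]_(size b, size c)) (alpha : 'M[S]_(size a, size b)).
Hypotheses (betaP : is_hom 0 beta) (alphaP : is_hom 0 alpha).
Hypothesis ab0 : alpha *m beta = 0.
Hypothesis beta_inj :
  forall u v : 'cV[S]_(size c), beta *m u = beta *m v -> u = v.

Lemma imageP t (v : 'cV[S]_(size b)) :
  image beta t v <-> in_piece t v /\ in_image beta v.
Proof.
split=> [[u ut ->]|[vt [u eqv]]]; first by split; [apply: in_piece_mulmx | exists u].
exists (hpartv t u); first exact: in_piece_hpartv.
by rewrite -hpartv_mulmx // -eqv hpartv_id.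
Qed.

Lemma image0 t : image beta t 0.
Proof. by apply/imageP; split; [apply: in_piece0 | apply: in_image0]. Qed.

Lemma imageD t u v : image beta t u -> image beta t v -> image beta t (u + v).
Proof.
move=> /imageP[ut uI] /imageP[vt vI]; apply/imageP.
by split; [apply: in_pieceD | apply: in_imageD].
Qed.

Lemma imageC t (z : k) v : image beta t v -> image beta t (z%:MP *: v).
Proof.
move=> /imageP[vt vI]; apply/imageP.
by split; [apply: in_pieceC | apply: in_imageZ].
Qed.

(** In degree t, the monad is a complex of vector spaces with an injective first
map and a surjective last one.  A basis of the cohomology is one of a
complement W of the row space of the matrix B in the kernel of A. *)
Lemma cohomology_dim t :
  (forall w : 'cV[S]_(size a), in_piece t w ->
     exists2 v : 'cV[S]_(size b), in_piece t v & alpha *m v = w) ->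
  exists2 n, quotient_dim (kernel alpha t) (image beta t) n &
    (n + piece_dim a t + piece_dim c t)%N = piece_dim b t.
Proof.
move=> alpha_surj; pose A := piece_mx t alpha; pose B := piece_mx t beta.
have kerA z : (alpha *m vec_of z == 0) = (z *m A == 0).
  rewrite mulmx_vec_of //; apply/eqP/eqP => [|->].
    move/(congr1 (coord t)); rewrite vec_ofK => ->.
    by apply/rowP => j; rewrite !mxE mcoeff0.
  by rewrite /vec_of big1 // => j _; rewrite mxE mpolyC0 scale0r.
have vec_row i : vec_of (row i B) = beta *m basis_vec k i.
  by rewrite rowK coordK //; apply: in_piece_mulmx (in_piece_basis_vec k _).
have BA0 : B *m A = 0.
  apply/row_matrixP => i; rewrite row_mul row0; apply/eqP; rewrite -kerA.
  by rewrite vec_row mulmxA ab0 mul0mx.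
have rkA : \rank A = piece_dim a t.
  rewrite -size_piece_index; apply/eqP; apply/row_fullP.
  have /fin_all_exists[y yP] (j : 'I_(size (piece_index a t))) :
      exists y : 'rV_(size (piece_index b t)), y *m A = delta_mx 0 j.
    have [v vt av] := alpha_surj _ (in_piece_vec_of (delta_mx 0 j)).
    exists (coord t v); apply: (can_inj (@vec_ofK _ _ _)).
    by rewrite -mulmx_vec_of // coordK.
  exists (\matrix_j y j); apply/row_matrixP => j.
  by rewrite row_mul rowK yP rowE mulmx1.
have rkB : \rank B = piece_dim c t.
  rewrite -size_piece_index; apply/eqP; apply: inj_row_free => z zB.
  apply: (can_inj (@vec_ofK _ _ _)); apply: beta_inj.
  by rewrite !mulmx_vec_of // zB mul0mx.
have BkerA : (B <= kermx A)%MS by apply/sub_kermxP.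
(* The row space of B lies in the kernel of A, so W has the dimension wanted. *)
pose W := (kermx A :\: B)%MS.
have rkW : (\rank W + piece_dim a t + piece_dim c t)%N = piece_dim b t.
  have := mxrank_cap_compl (kermx A) B; rewrite (capmx_idPr BkerA) rkB.
  rewrite mxrank_ker rkA -/W; have := rank_leq_row A; rewrite rkA.
  by have := size_piece_index b t; lia.
exists (\rank W) => //; exists (fun i => vec_of (row i (row_base W))); split.
- move=> i; split; first exact: in_piece_vec_of.
  apply/eqP; rewrite kerA; apply/eqP/sub_kermxP.
  apply: submx_trans (row_sub _ _) _; rewrite eq_row_base.
  exact: diffmxSl.
- move=> v [vt vK].
  have : (coord t v <= W + kermx A :&: B)%MS.
    rewrite (addsmx_diff_cap_eq (kermx A) B); apply/sub_kermxP/eqP.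
    by rewrite -kerA coordK // vK.
  move=> /submx_trans/(_ (addsmxS (submx_refl W) (capmxSr _ _))).
  case/sub_addsmxP=> [[x y] /= eqv].
  have : (x *m W <= row_base W)%MS by rewrite eq_row_base submxMl.
  case/submxP=> z eqz; exists (z 0).
  have -> : v - \sum_i (z 0 i)%:MP *: vec_of (row i (row_base W)) = vec_of (y *m B).
    rewrite -vec_of_mul -eqz -[v in LHS](coordK vt) eqv.
    apply/eqP; rewrite subr_eq; apply/eqP; rewrite /vec_of -big_split /=.
    by apply: eq_bigr => j _; rewrite -scalerDl -mpolyCD mxE addrC.
  exists (vec_of y); first exact: in_piece_vec_of.
  by rewrite mulmx_vec_of.
have vecE z : vec_of ((\row_i z i) *m row_base W) =
    \sum_i (z i)%:MP *: vec_of (row i (row_base W)) :> 'cV[S]_(size b).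
  by rewrite vec_of_mul; apply: eq_bigr => i _; rewrite mxE.
move=> z; rewrite -vecE; case=> u ut; rewrite -(coordK ut) mulmx_vec_of // => /(congr1 (coord t)).
rewrite !vec_ofK => eqz i.
have : ((\row_i z i) *m row_base W <= W :&: B)%MS.
  by rewrite sub_capmx {2}eqz submxMl andbT -(eq_row_base W) submxMl.
rewrite capmx_diff submx0 => /eqP zW.
have /rowP/(_ i) : \row_i z i = 0.
  by apply: (row_free_inj (row_base_free W)); rewrite zW mul0mx.
by rewrite !mxE.
Qed.

End Cohomology.

Section HilbertPolynomials.
Implicit Types (f p q : {poly rat}) (x : int) (b : seq int).

(** Compare f with its term of degree n.  At T >= 1, the terms of lower degree add
up to at most C T^(n - 1), which a negative term of degree n outweighs for
large T. *)
Lemma poly_asymptotic_coef f n t0 :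
  (forall t : nat, (t0 <= t)%N -> 0 <= f.[t%:R]) ->
  (forall i, (n < i)%N -> f`_i = 0) -> 0 <= f`_n.
Proof.
move=> f_ge0 f_hi; rewrite leNgt; apply/negP => fn0.
have fE (x : rat) : f.[x] = \sum_(i < n) f`_i * x ^+ i + f`_n * x ^+ n.
  rewrite (@horner_coef_wide _ n.+1) ?big_ord_recr //=.
  by apply/leq_sizeP => j /f_hi.
case: n => [|n] in fn0 f_hi fE *.
  by have := f_ge0 t0 (leqnn _); rewrite fE big_ord0 add0r expr0 mulr1 leNgt fn0.
(* A bound for the terms of lower degree, and a point T where it is too small. *)
pose C := \sum_(i < n.+1) `|f`_i|.
have C0 : 0 <= C by apply: sumr_ge0.
pose T := (maxn t0 (maxn 1 (Num.bound (C / - f`_n.+1)))).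
have T1 : 1 <= T%:R :> rat by rewrite ler1n; lia.
have CT : C < - f`_n.+1 * T%:R.
  rewrite mulrC -ltr_pdivrMr ?oppr_gt0 //.
  apply: (lt_le_trans (archi_boundP _)); first by rewrite divr_ge0 // oppr_ge0 ltW.
  by rewrite ler_nat /T !leq_max leqnn !orbT.
have le_C : \sum_(i < n.+1) f`_i * T%:R ^+ i <= C * T%:R ^+ n.
  rewrite mulr_suml; apply: ler_sum => i _.
  apply: (@le_trans _ _ (`|f`_i| * T%:R ^+ i)).
    by rewrite ler_wpM2r ?exprn_ge0 ?ler_norm // (le_trans ler01 T1).
  by rewrite ler_wpM2l // ler_weXn2l // -ltnS.
have Tn : 0 < T%:R ^+ n :> rat by rewrite exprn_gt0 // (lt_le_trans ltr01 T1).
have /f_ge0 : (t0 <= T)%N by lia.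
rewrite fE exprS mulrA; nra.
Qed.

(** The polynomial 'C(t + x + 3, 3) in t, expanded. *)
Definition line_poly x : {poly rat} := let y := x%:~R in
  Poly [:: (y + 1) * (y + 2) * (y + 3) / 6;
           (3 * y ^+ 2 + 12 * y + 11) / 6; (y + 2) / 2; 6^-1].

Definition hilbert b : {poly rat} := \sum_(x <- b) line_poly x.

Lemma line_polyE x (t : nat) : 0 <= x + t%:Z ->
  (line_poly x).[t%:R] = (hdim (x + t%:Z))%:R.
Proof.
case eqd: (x + t%:Z) => [d|//] _ /=.
have eqx : x%:~R = d%:R - t%:R :> rat.
  by rewrite -(addrK t%:Z x) eqd rmorphB.
have eqC : 6 * ('C(d + 3, 3))%:R = (d%:R + 1) * (d%:R + 2) * (d%:R + 3) :> rat.
  have := bin_ffact (d + 3) 3; rewrite !addnS addn0 !ffactnS ffactn0 !muln1 /=.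
  move=> /(congr1 (fun n => n%:R : rat)); rewrite !natrM => eqC.
  rewrite mulrC [LHS]eqC -!(natrD _ d) !addnS addn0; ring.
rewrite horner_Poly /= eqx mul0r add0r; lra.
Qed.

Lemma coef_line_poly x :
  [/\ (line_poly x)`_3 = 6^-1, (line_poly x)`_2 = (x%:~R + 2) / 2
    & forall i, (3 < i)%N -> (line_poly x)`_i = 0].
Proof. by split=> [||[|[|[|[|i]]]] //] *; rewrite coef_Poly /= ?nth_nil. Qed.

Lemma hilbertE b : exists T, forall t : nat, (T <= t)%N ->
  (hilbert b).[t%:R] = (piece_dim b t)%:R.
Proof.
elim: b => [|x b [T IHb]].
  by exists 0 => t _; rewrite /hilbert /piece_dim !big_nil horner0.
exists (maxn T `|x|%N) => t tT; rewrite /hilbert /piece_dim !big_cons hornerD natrD.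
by rewrite -/(hilbert b) -/(piece_dim b t) IHb ?line_polyE //; lia.
Qed.

Lemma coef_hilbert b :
  [/\ (hilbert b)`_3 = (size b)%:R / 6,
      (hilbert b)`_2 = (\sum_(x <- b) x)%:~R / 2 + (size b)%:R
    & forall i, (3 < i)%N -> (hilbert b)`_i = 0].
Proof.
rewrite /hilbert; elim: b => [|x b [IH3 IH2 IHi]].
  by rewrite !big_nil; split=> [||i _]; rewrite coef0 ?mul0r ?addr0.
have [x3 x2 xi] := coef_line_poly x.
rewrite !big_cons; split=> [||i i3]; rewrite coefD.
- by rewrite IH3 x3 /= -[(size b).+1%:R]natr1; lra.
- by rewrite IH2 x2 rmorphD /= -[(size b).+1%:R]natr1; lra.
- by rewrite IHi ?xi ?addr0.
Qed.

End HilbertPolynomials.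

(** * Stability *)

Section Growth.
Implicit Types p q f : {poly rat}.

Definition eventually_le p q :=
  exists t0 : nat, forall t : nat, (t0 <= t)%N -> p.[t%:R] <= q.[t%:R].

Lemma eventually_le_coef p q n : eventually_le p q ->
  (forall i, (n < i)%N -> p`_i = q`_i) -> p`_n <= q`_n.
Proof.
case=> t0 le_pq eq_pq; rewrite -subr_ge0 -coefB.
apply: (@poly_asymptotic_coef _ _ t0) => [t /le_pq|i /eq_pq eqi].
  by rewrite hornerD hornerN subr_ge0.
by rewrite coefB eqi subrr.
Qed.

(** If the degree of p exceeded n, then its leading coefficient would be both
nonnegative, as p is, and nonpositive, as q - p is nonnegative. *)
Lemma squeeze_coef p q n : eventually_le 0 p -> eventually_le p q ->
  (forall i, (n < i)%N -> q`_i = 0) -> forall i, (n < i)%N -> p`_i = 0.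
Proof.
move=> p_ge0 le_pq qn i ni; apply/eqP; apply: contraT => pi0.
have szp : (n < (size p).-1)%N.
  have : (i < size p)%N by rewrite ltnNge; apply: contra pi0 => /leq_sizeP ->.
  by lia.
have p0 : p != 0 by apply: contraNneq pi0 => ->; rewrite coef0.
have hi j : ((size p).-1 < j)%N -> p`_j = 0.
  by move=> szj; apply/leq_sizeP: j szj; rewrite prednK ?size_poly_gt0.
have lead_le0 : p`_(size p).-1 <= 0.
  rewrite -[X in _ <= X](qn _ szp); apply: (eventually_le_coef le_pq) => j szj.
  by rewrite hi // qn //; apply: ltn_trans szj.
have lead_ge0 : 0 <= p`_(size p).-1.
  rewrite -[X in X <= _](coef0 _ (size p).-1).
  apply: (eventually_le_coef p_ge0) => j szj.
  by rewrite hi // coef0.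
by move: p0; rewrite -lead_coef_eq0 lead_coefE eq_le lead_le0 lead_ge0.
Qed.

End Growth.

Section Stability.
Variables (k : fieldType) (c b a : seq int).
Local Notation S := {mpoly k[4]}.
Variables (beta : 'M[S]_(size b, size c)) (alpha : 'M[S]_(size a, size b)).
Hypotheses (betaP : is_hom 0 beta) (alphaP : is_hom 0 alpha).
Hypothesis ab0 : alpha *m beta = 0.
Hypothesis gammaP : forall i : 'I_4, exists N (gamma : 'M[S]_(size c, size b)),
  gamma *m beta = ('X_i ^+ N)%:M.
Hypothesis deltaP : forall i : 'I_4, exists N (delta : 'M[S]_(size b, size a)),
  alpha *m delta = ('X_i ^+ N)%:M.
Hypothesis no_section :
  forall v : 'cV[S]_(size b), in_piece 0 v -> alpha *m v = 0 -> v = 0.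
Hypothesis rank2 : size b = (size a + size c + 2)%N.
Hypothesis degree_odd : \sum_(x <- b) x = \sum_(x <- a) x + \sum_(x <- c) x - 1.

(** A monomial of large degree is divisible by one of the X_i^N_i, which factors
through alpha. *)
Lemma surjective_large_degree : exists T : nat, forall t, T%:Z <= t ->
  forall w : 'cV[S]_(size a), in_piece t w ->
  exists2 v : 'cV[S]_(size b), in_piece t v & alpha *m v = w.
Proof.
have [N /fin_all_exists[delta dP]] := fin_all_exists deltaP.
pose ab (i : 'I_(size a)) : nat := `|(a`_i)%R|%N.
exists (\sum_i N i + \max_i ab i)%N => t tT w wt.
suff [v eqw] : in_image alpha w.
  exists (hpartv t v); first exact: in_piece_hpartv.
  by rewrite -hpartv_mulmx // -eqw hpartv_id.
rewrite [w]col_sum_delta; apply: in_image_sum => j _.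
move/in_pieceP: wt => /(_ j) /monomial_expansion ->.
rewrite scaler_suml big_seq; apply: in_image_sum => m.
rewrite mem_monomials => /eqP md.
rewrite -scalerA; apply: in_imageZ.
have le_ab : (ab j <= \max_i ab i)%N by apply: leq_bigmax.
have lt_N : (\sum_i N i <= mdeg m)%N by move: le_ab tT; rewrite {1}/ab; lia.
have [i Ni] : exists i, (N i <= m i)%N.
  apply/existsP; apply: contraLR lt_N; rewrite negb_exists -ltnNge => /forallP mN.
  rewrite mdegE; apply: (@leq_trans (\sum_(i < 4) (m i).+1)); last first.
    by apply: leq_sum => i _; rewrite ltnNge; apply: mN.
  by rewrite !big_ord_recr !big_ord0 /=; lia.
exists (delta i *m ('X_[m - U_(i) *+ N i] *: delta_mx j 0)).
by rewrite mulmxA dP mul_scalar_mx scalerA -varX_factor.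
Qed.

Let binj := beta_inj gammaP.

Definition cohomology_poly := hilbert b - hilbert a - hilbert c.

Lemma cohomology_hilbert :
  hilbert_polynomial (kernel alpha) (image beta) cohomology_poly.
Proof.
have [T surj] := surjective_large_degree.
have [Tb bP] := hilbertE b; have [Ta aP] := hilbertE a.
have [Tc cP] := hilbertE c.
exists (T + Tb + Ta + Tc)%N => t tT.
have [|n nP eqn] := cohomology_dim betaP alphaP ab0 binj (t := t).
  by apply: surj; lia.
exists n => //; rewrite !hornerD !hornerN bP ?aP ?cP; try lia.
by rewrite -eqn !natrD; ring.
Qed.

Lemma coef_cohomology_poly :
  [/\ cohomology_poly`_3 = 2 / 6, cohomology_poly`_2 = 3 / 2
    & forall i, (3 < i)%N -> cohomology_poly`_i = 0].
Proof.
have [a3 a2 ai] := coef_hilbert a; have [b3 b2 bi] := coef_hilbert b.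
have [c3 c2 ci] := coef_hilbert c.
split=> [||i i3]; rewrite !coefB ?a3 ?b3 ?c3 ?a2 ?b2 ?c2 ?rank2 ?natrD.
- lra.
- by rewrite degree_odd rmorphB rmorphD /=; lra.
- by rewrite ai ?bi ?ci ?subr0.
Qed.

Section Submodule.
Variables (N : Defs.family k b) (p : {poly rat}).
Hypothesis Ngr : graded_submodule N.
Hypothesis NK : subfamily N (kernel alpha).
Hypothesis Np : hilbert_polynomial N (image beta) p.

(** The two bounds for the dimension of a piece of N / I from which its Hilbert
polynomial is estimated. *)
Lemma sub_lower (I : finType) (t : int) n (e : I -> 'cV[S]_(size b)) :
  quotient_dim (N t) (image beta t) n -> (forall i, N t (e i)) ->
  independent_mod (image beta t) e -> (#|I| <= n)%N.
Proof.
case=> f [fN fspan _] eN ind; rewrite -[n]card_ord.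
apply: (steinitz_mod (f := f) (image0 betaP t) (@imageD _ _ _ _ betaP t)
  (@imageC _ _ _ _ betaP t) _ ind) => i.
exact/fspan/eN.
Qed.

Lemma sub_upper (J : finType) (t : int) n (f : J -> 'cV[S]_(size b)) :
  quotient_dim (N t) (image beta t) n ->
  (forall v, N t v -> spanned_mod (image beta t) f v) -> (n <= #|J|)%N.
Proof.
case=> e [eN _ ind] span; rewrite -[n]card_ord.
apply: (steinitz_mod (image0 betaP t) (@imageD _ _ _ _ betaP t)
  (@imageC _ _ _ _ betaP t) _ ind) => i.
exact/span/eN.
Qed.

Lemma sub_ge0 : eventually_le 0 p.
Proof.
have [T pT] := Np; exists T => t /pT[n _ ->].
by rewrite horner0 ler0n.
Qed.

Lemma sub_le : eventually_le p cohomology_poly.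
Proof.
have [T pT] := Np; have [T' qT] := cohomology_hilbert.
exists (T + T')%N => t tT; have [|n np ->] := pT t; first by lia.
have [|m [f [_ fspan _]] ->] := qT t; first by lia.
rewrite ler_nat -[m]card_ord; apply: (sub_upper (f := f) np) => v /NK /fspan.
by [].
Qed.

(** The Hilbert polynomial of N / I has degree at most 3, being at most that of
K / I. *)
Lemma sub_coef i : (3 < i)%N -> p`_i = 0.
Proof.
have [_ _ q0] := coef_cohomology_poly.
exact: (squeeze_coef sub_ge0 sub_le q0).
Qed.

Lemma multiple_in d s t f : N d s -> of_degree (t - d) f -> N t (f *: s).
Proof.
have [_ _ _ NZ] := Ngr => sN fd.
by have := NZ _ _ _ _ fd sN; rewrite addrC subrK.
Qed.

Lemma multiples_sum d (z : 'I_(size (monomials d)) -> k) (s : 'cV[S]_(size b)) :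
  \sum_i (z i)%:MP *: (monomial k i *: s) =
  (\sum_i (z i)%:MP * monomial k i) *: s.
Proof. by rewrite scaler_suml; apply: eq_bigr => i _; rewrite scalerA. Qed.

(** The multiples of s form a copy of O(-d) in the sheaf of N / I. *)
Lemma sub_rank_one d s : N d s -> ~ in_image beta s ->
  eventually_le (line_poly (- d)) p.
Proof.
move=> sN sI; have [T pT] := Np; exists (T + `|d|)%N => t tT.
have [|n np ->] := pT t; first by lia.
rewrite line_polyE; last by lia.
rewrite ler_nat -size_monomials -[X in (X <= _)%N]card_ord.
apply: (sub_lower (e := fun i => monomial k i *: s) np).
  by move=> i; apply: (multiple_in sN); rewrite addrC; apply: monomial_degree.
move=> z; rewrite multiples_sum => /(imageP betaP)[_ zI].
apply: monomial_free; apply/eqP; apply: contra_notT sI => z0.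
exact: (in_image_torsion_free gammaP z0 zI).
Qed.

(** The multiples of s and s' form a copy of O(-d) + O(-d'). *)
Lemma sub_rank_two d s d' s' : N d s -> ~ in_image beta s -> N d' s' ->
  ~ dependent beta s s' ->
  eventually_le (line_poly (- d) + line_poly (- d')) p.
Proof.
move=> sN sI s'N s's; have [T pT] := Np; exists (T + `|d| + `|d'|)%N => t tT.
have [|n np ->] := pT t; first by lia.
rewrite hornerD !line_polyE; try lia.
rewrite -natrD ler_nat -!size_monomials.
rewrite -[X in (X + _ <= _)%N]card_ord -[X in (_ + X <= _)%N]card_ord -card_sum.
pose e (i : ('I_(size (monomials (- d + t)))%R +
             'I_(size (monomials (- d' + t))%R))%type) :=
  match i with inl i => monomial k i *: s | inr i => monomial k i *: s' end.
apply: (sub_lower (e := e) np).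
  case=> i; first by apply: (multiple_in sN); rewrite addrC; apply: monomial_degree.
  by apply: (multiple_in s'N); rewrite addrC; apply: monomial_degree.
move=> z; rewrite big_sumType /= multiples_sum (multiples_sum (z \o inr)).
set f := \sum_i _; set g := \sum_i _ => /(imageP betaP)[_ fgI].
have g0 : g = 0.
  apply/eqP; apply: contra_notT s's => g0; exists g, (- f); split=> //.
  by rewrite scaleNr opprK addrC.
have f0 : f = 0.
  apply/eqP; apply: contra_notT sI => f0.
  by apply: (in_image_torsion_free gammaP f0); rewrite g0 scale0r addr0 in fgI.
by case=> i; [apply: (monomial_free f0) | apply: (monomial_free g0)].
Qed.

(** If N is contained in I, then its sheaf has rank 0.  If N contains two elements
independent modulo I, then it has rank 2 at least.  Otherwise N lies in
I + S u with u as in [rank_one_generator], so that its sheaf has rank 1 and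
degree at most that of O(-e) with e > 0. *)
Lemma sub_slope : 0 < sheaf_rank p < 2 -> slope p <= -1.
Proof.
case/andP=> rk0 rk2; have e6 : 3`!%:R = 6 :> rat by [].
have [[d [s [sN sI]]]|allI] :=
    classic (exists d s, N d s /\ ~ in_image beta s); last first.
  suff p3 : p`_3 <= 0 by move: rk0; rewrite /sheaf_rank e6; lra.
  rewrite -[X in _ <= X](coef0 _ 3).
  apply: eventually_le_coef => [|i /sub_coef ->]; last by rewrite coef0.
  have [T pT] := Np; exists T => t /pT[n np ->]; rewrite horner0 lern0.
  rewrite -leqn0 -[X in (_ <= X)%N](card_ord 0).
  apply: (sub_upper (f := fun _ => 0) np) => v vN; exists (fun _ => 0).
  rewrite big_ord0 subr0; apply/(imageP betaP).
  split; first by have [NP _ _ _] := Ngr; apply: NP.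
  by apply: NNPP => vI; apply: allI; exists t%:Z, v.
have sp3 : p`_3 >= 6^-1.
  have [<- _ li] := coef_line_poly (- d).
  apply: (eventually_le_coef (sub_rank_one sN sI)) => i i3.
  by rewrite li // sub_coef.
have [[d' [s' [s'N s's]]]|dep] :=
    classic (exists d' s', N d' s' /\ ~ dependent beta s s').
  suff : p`_3 >= 6^-1 + 6^-1 by move: rk2; rewrite /sheaf_rank e6; lra.
  have [e3 _ li] := coef_line_poly (- d).
  have [e3' _ li'] := coef_line_poly (- d').
  rewrite -{1}e3 -e3' -coefD.
  apply: (eventually_le_coef (sub_rank_two sN sI s'N s's)).
  by move=> i i3; rewrite coefD li ?li' ?sub_coef ?addr0.
have sdeg : in_piece d s by have [NP _ _ _] := Ngr; apply: NP.
have [_ sK] := NK sN.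
have [e [u [e0 ue uK uI gen]]] :=
  rank_one_generator betaP alphaP ab0 gammaP no_section sdeg sK sI.
have upper : eventually_le p (line_poly (- e)).
  have [T pT] := Np; exists (T + `|e|)%N => t tT.
  have [|n np ->] := pT t; first by lia.
  rewrite line_polyE; last by lia.
  rewrite ler_nat -size_monomials -[X in (_ <= X)%N]card_ord.
  apply: (sub_upper (f := fun i => monomial k i *: u) np) => v vN.
  have vt : in_piece t%:Z v by have [NP _ _ _] := Ngr; apply: NP.
  have [_ vK] := NK vN.
  have [|f fd vI] := gen _ _ vt vK.
    by apply: NNPP => vs; apply: dep; exists t%:Z, v.
  have [z eqf] := monomial_span fd; rewrite addrC; exists z.
  rewrite multiples_sum -eqf; apply/(imageP betaP); split=> //.
  apply: in_pieceB => //.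
  by have := in_pieceZ fd ue; rewrite addrC subrK.
have [l3 l2 li] := coef_line_poly (- e).
have p3 : p`_3 = 6^-1.
  apply/le_anti; rewrite sp3 andbT -[X in _ <= X]l3.
  apply: (eventually_le_coef upper) => i i3.
  by rewrite li // sub_coef.
have : p`_2 <= (line_poly (- e))`_2.
  apply: (eventually_le_coef upper) => i; rewrite leq_eqVlt => /orP[/eqP <-|i3].
    by rewrite p3 l3.
  by rewrite li // sub_coef.
rewrite l2 /slope /sheaf_degree /sheaf_rank p3.
have : 1 <= e%:~R :> rat by rewrite ler1z.
rewrite rmorphN /=; set y := e%:~R => y1 p2.
have -> : 3`!%:R * 6^-1 = 1 :> rat by [].
have -> : 2`!%:R = 2 :> rat by [].
by rewrite divr1; lra.
Qed.

End Submodule.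

Theorem stable_of_no_section : slope_stable (kernel alpha) (image beta).
Proof.
have [q3 q2 _] := coef_cohomology_poly.
have qr : sheaf_rank cohomology_poly = 2 by rewrite /sheaf_rank q3.
have qs : slope cohomology_poly = - (1 / 2).
  by rewrite /slope /sheaf_degree qr q2.
exists cohomology_poly; first exact: cohomology_hilbert.
move=> N p Ngr IN NK Np; rewrite qr qs => /(sub_slope Ngr NK Np) sp; lra.
Qed.

End Stability.

(** * Minimality *)

Section Minimality.
Variable k : fieldType.
Local Notation S := {mpoly k[4]}.

Definition no_constant_term m n (M : 'M[S]_(m, n)) :=
  forall i j, (M i j)@_0%MM = 0.

Lemma no_constant_term_mul m n p (M : 'M[S]_(m, n)) (A : 'M_(n, p)) :
  no_constant_term M -> no_constant_term (M *m A).
Proof.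
move=> M0 i j; rewrite mxE raddf_sum big1 // => l _ /=.
by rewrite rmorphM /= M0 mul0r.
Qed.

(** The matrix 1 - e kills e, and its determinant has constant term 1. *)
Lemma idempotent_no_constant n (e : 'M[S]_n) :
  e *m e = e -> no_constant_term e -> e = 0.
Proof.
move=> ee e0; pose f := 1%:M - e.
have fe : f *m e = 0 by rewrite mulmxBl mul1mx ee subrr.
have det_f : \det f != 0.
  suff : (\det f)@_0%MM = 1.
    move=> d1; apply: contra_eq_neq d1 => ->.
    by rewrite mcoeff0 eq_sym oner_neq0.
  rewrite -(det_map_mx (mcoeff 0%MM)) (_ : map_mx _ f = 1%:M) ?det1 //.
  apply/matrixP => i j; rewrite !mxE raddfB /= e0 subr0.
  by case: (i == j); rewrite /= ?mcoeff1 ?eqxx ?mcoeff0.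
apply: (scalemx_cancel det_f); rewrite scaler0 -mul_scalar_mx -mul_adj_mx.
by rewrite -mulmxA fe mulmx0.
Qed.

Lemma in_piece_delta b (j : 'I_(size b)) :
  in_piece (- b`_j) (delta_mx j 0 : 'cV[S]_(size b)).
Proof.
apply/in_pieceP => i; rewrite mxE eqxx andbT.
by case: eqP => [->|_]; rewrite ?of_degree0 // subrr -mpolyC1 of_degreeC.
Qed.

(** A column v of f with a nonzero constant term is a section of the sheaf of the
image of L.  So X_0^N v and X_1^N v are in the image of L = M P for large N.
As P u is determined by L u, the two elements P u_0 and P u_1 so obtained satisfy
X_1^N P u_0 = X_0^N P u_1, hence P u_0 is X_0^N z and v = M z.  With M = alpha
and P = l, and with M = beta and P = e, this covers both conditions of
minimality. *)
Lemma no_summand_image (b c : seq int) q (f : 'M[S]_(size b, size b))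
    (L : 'M[S]_(size b, size c)) (M : 'M[S]_(size b, q))
    (P : 'M[S]_(q, size c)) :
  nonzero_projector f -> no_constant_term M -> L = M *m P ->
  (L != 0 -> forall u v : 'cV_(size c), L *m u = L *m v -> P *m u = P *m v) ->
  ~ same_subsheaf (image L) (image f).
Proof.
move=> [fP ff f0] M0 LE Pdet [t0 LfE].
have [j nj] : exists j, ~ no_constant_term (f *m (delta_mx j 0 : 'cV_(size b))).
  apply: not_all_ex_not => f_const; case/eqP: f0.
  apply: idempotent_no_constant => // i j.
  have := f_const j i 0; rewrite -colE mxE.
  by [].
apply: nj; set v := f *m _; pose N : nat := `|(t0 + b`_j)%R|%N.
have XN i : exists u, 'X_i ^+ N *: v = L *m u.
  have [||u _ ->] := (LfE (- b`_j + N%:Z) _ ('X_i ^+ N *: v)).2; last by exists u.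
    by rewrite /N; lia.
  exists ('X_i ^+ N *: delta_mx j 0); last by rewrite scalemxAr.
  by apply: in_pieceZ (in_piece_delta j); apply: of_degree_varX.
have [u0 e0] := XN (inord 0); have [u1 e1] := XN (inord 1).
have X0N : 'X_(inord 0) ^+ N != 0 :> S by apply: varX_neq0.
have [->|v0] := eqVneq v 0; first by move=> i l; rewrite mxE mcoeff0.
have L0 : L != 0.
  apply: contra_neq v0 => L0; apply: (scalemx_cancel X0N).
  by rewrite e0 L0 mul0mx scaler0.
have [||z eqz] := @varX_coprime k 4 q (inord 0) (inord 1) N N (P *m u1) (P *m u0).
- by rewrite -val_eqE /= !inordK.
- rewrite !scalemxAr; apply: (Pdet L0).
  by rewrite -!scalemxAr -e0 -e1 !scalerA mulrC.
suff -> : v = M *m z by apply: no_constant_term_mul.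
by apply: (scalemx_cancel X0N); rewrite e0 LE -mulmxA eqz scalemxAr.
Qed.

Lemma minimal_of_no_constant (c b a : seq int)
    (beta : 'M[S]_(size b, size c)) (alpha : 'M[S]_(size a, size b)) :
  (forall u v : 'cV_(size c), beta *m u = beta *m v -> u = v) ->
  no_constant_term alpha -> no_constant_term beta -> is_minimal beta alpha.
Proof.
move=> binj a0 b0; split.
  case=> d [l [e [lP _ eP]]].
  apply: (no_summand_image (M := alpha) (P := l) eP a0 (erefl _)) => L0 u v eqL.
  have [i Li] : exists i, (alpha *m l) i 0 != 0.
    apply/existsP; apply: contraNT L0; rewrite negb_exists => /forallP L0.
    apply/eqP/matrixP => i j; rewrite (ord1 j) [RHS]mxE; apply/eqP.
    by have := L0 i; rewrite negbK.
  congr mulmx; apply/matrixP => j j'; rewrite (ord1 j) (ord1 j').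
  have /matrixP/(_ i 0) := eqL.
  rewrite [LHS]mxE [RHS]mxE !big_ord1; exact: mulfI.
case=> e [f [eP fP]].
apply: (no_summand_image (M := beta) (P := e) fP b0 (erefl _)) => _ u v.
by rewrite -!mulmxA => /binj.
Qed.

End Minimality.

(** * Computing with sparse integral polynomials *)

Definition expo := (nat * nat * nat * nat)%type.
(** Polynomials are unnormalized lists of terms, the exponents being 4-tuples of
numbers.  Coefficients are only collected by [scoef], when a polynomial is
tested for zero. *)
Definition spoly := seq (int * expo).

Definition expo_nth (e : expo) (l : nat) : nat :=
  nth 0%N [:: e.1.1.1; e.1.1.2; e.1.2; e.2] l.
Definition expo_add (e f : expo) : expo :=
  ((e.1.1.1 + f.1.1.1)%N, (e.1.1.2 + f.1.1.2)%N,
   (e.1.2 + f.1.2)%N, (e.2 + f.2)%N).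
Definition expo_deg (e : expo) : nat := (e.1.1.1 + e.1.1.2 + e.1.2 + e.2)%N.

Definition smul (p q : spoly) : spoly :=
  [seq (t.1 * u.1, expo_add t.2 u.2) | t <- p, u <- q].
Definition sopp (p : spoly) : spoly := [seq (- t.1, t.2) | t <- p].
Definition sone : spoly := [:: (1, (0, 0, 0, 0)%N)].
Definition sexp (p : spoly) n : spoly := iter n (smul p) sone.
Definition svar (l : nat) : spoly :=
  [:: (1, ((l == 0) : nat, (l == 1) : nat, (l == 2) : nat, (l == 3) : nat)%N)].
Definition scoef (p : spoly) (e : expo) : int :=
  foldr (fun t s => if t.2 == e then t.1 + s else s) 0 p.

(** The product of a row with a column, where the column [comb] is given as a
list of entries with their positions; repeated positions add up. *)
Definition sdot (row : seq spoly) (comb : seq (nat * spoly)) : spoly :=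
  flatten [seq smul (nth [::] row t.1) t.2 | t <- comb].

(** A sufficient condition for p to lie in the ideal of the variables in L. *)
Definition in_vars (L : seq nat) (p : spoly) : bool :=
  all (fun t => has (fun l => 0 < expo_nth t.2 l)%N L || (scoef p t.2 == 0)) p.

(** The product of the matrix with the column [comb] is X_v^N times the basis vector
j, modulo the variables in L. *)
Definition column_ok (n : nat) (rows : seq (seq spoly)) (L : seq nat) v N
    (j : nat) (comb : seq (nat * spoly)) : bool :=
  all (fun t => t.1 < n)%N comb &&
  all (fun i => in_vars L (sdot (nth [::] rows i) comb ++
                  (if i == j then sopp (sexp (svar v) N) else [::])))
    (iota 0 (size rows)).

(** A step gives, for one variable v and each basis vector of the target, a preimage
of X_v^N times this vector modulo the variables L of the previous steps. *)
Fixpoint chain_ok n (rows : seq (seq spoly)) (L : seq nat)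
    (steps : seq (nat * nat * seq (seq (nat * spoly)))) : bool :=
  if steps is (v, N, combs) :: steps' then
    (v < 4)%N && (v \notin L) &&
    all (fun j => column_ok n rows L v N j (nth [::] combs j))
      (iota 0 (size rows))
    && chain_ok n rows (v :: L) steps'
  else all (mem L) (iota 0 4).

Definition expos (d : int) : seq expo :=
  if d is Posz n then
    let pairs := [seq (i, j) | i <- iota 0 n.+1, j <- iota 0 n.+1] in
    [seq e <- [seq (p, q.1, q.2) : expo | p <- pairs, q <- pairs]
      | expo_deg e == n]
  else [::].

(** The unknowns: the coefficients of a column of degree 0. *)
Definition column_index (b : seq int) : seq (nat * expo) :=
  [seq (j, e) | j <- iota 0 (size b), e <- expos (nth 0 b j)].

(** The coefficient of the unknown t in the coefficient at e of the product with
[row]. *)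
Definition unknown_coef (row : seq spoly) (e : expo) (t : nat * expo) : int :=
  scoef (smul (nth [::] row t.1) [:: (1, t.2)]) e.

(** Some linear equation involves t, with coefficient 1 or -1, and no other of the
unknowns l.  Only monomials that occur in the entry multiplied by t need to be
tried. *)
Definition isolated (rows : seq (seq spoly)) (l : seq (nat * expo)) t : bool :=
  has (fun row => has (fun u =>
      let e := expo_add u.2 t.2 in
      (unknown_coef row e t \in [:: 1; -1]) &&
      all (fun t' => (t' == t) || (unknown_coef row e t' == 0)) l)
    (nth [::] row t.1)) rows.

(** All isolated unknowns are dropped at once: each of them vanishes because all
unknowns outside l do. *)
Definition eliminate rows n l :=
  iter n (fun l => [seq t <- l | ~~ isolated rows l t]) l.

Definition injective_degree0 (b : seq int) rows : bool :=
  nilp (eliminate rows (size (column_index b)) (column_index b)).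

Definition is_hom_rows (b a : seq int) (rows : seq (seq spoly)) : bool :=
  all (fun i => all (fun j => all (fun t =>
      (0 < expo_deg t.2)%N && ((expo_deg t.2)%:Z == nth 0 a i - nth 0 b j))
    (nth [::] (nth [::] rows i) j)) (iota 0 (size b))) (iota 0 (size a)).

Section Evaluation.
Variable k : fieldType.
Local Notation S := {mpoly k[4]}.
Implicit Types (p q : spoly) (e f : expo).

Definition mon e : 'X_{1..4} := [multinom expo_nth e i | i < 4].

Definition seval p : S := \sum_(t <- p) t.1%:~R *: 'X_[mon t.2].

Lemma mon_inj : injective mon.
Proof.
move=> [[[e0 e1] e2] e3] [[[f0 f1] f2] f3] /mnmP eqm.
have E i : (i < 4)%N -> expo_nth (e0, e1, e2, e3) i = expo_nth (f0, f1, f2, f3) i.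
  by move=> i4; have := eqm (Ordinal i4); rewrite !mnmE.
have := E 0%N isT; have := E 1%N isT; have := E 2%N isT; have := E 3%N isT.
by rewrite /expo_nth /= => -> -> -> ->.
Qed.

Lemma mon_surj (m : 'X_{1..4}) : exists e, m = mon e.
Proof.
exists (m (inord 0), m (inord 1), m (inord 2), m (inord 3)).
apply/mnmP => i; rewrite mnmE.
by case: i => [[|[|[|[|]]]] lti] //=; congr (m _); apply: val_inj; rewrite /= inordK.
Qed.

Lemma mon_add e f : mon (expo_add e f) = (mon e + mon f)%MM.
Proof.
apply/mnmP => i; rewrite mnmDE !mnmE.
by case: i => [[|[|[|[|]]]] lti].
Qed.

Lemma mdeg_mon e : mdeg (mon e) = expo_deg e.
Proof. by rewrite mdegE !big_ord_recr big_ord0 !mnmE. Qed.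

Lemma mcoeff_seval p e : (seval p)@_(mon e) = (scoef p e)%:~R.
Proof.
rewrite /seval; elim: p => [|t p IHp]; first by rewrite big_nil mcoeff0.
rewrite big_cons mcoeffD IHp mcoeffZ mcoeffX (inj_eq mon_inj) /=.
by case: eqP => _; rewrite ?mulr1 ?mulr0 ?add0r ?rmorphD.
Qed.

Lemma seval_nil : seval [::] = 0. Proof. by rewrite /seval big_nil. Qed.

Lemma seval_cat p q : seval (p ++ q) = seval p + seval q.
Proof. by rewrite /seval big_cat. Qed.

Lemma seval_opp p : seval (sopp p) = - seval p.
Proof.
rewrite /seval big_map -sumrN; apply: eq_bigr => t _ /=.
by rewrite rmorphN scaleNr.
Qed.

Lemma seval_mul p q : seval (smul p q) = seval p * seval q.
Proof.
rewrite /seval big_allpairs_dep mulr_suml; apply: eq_bigr => t _.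
rewrite mulr_sumr; apply: eq_bigr => u _ /=.
by rewrite mon_add mpolyXD rmorphM -scalerA -scalerAl -scalerAr.
Qed.

Lemma seval_one : seval sone = 1.
Proof.
rewrite /seval big_seq1 scale1r (_ : mon _ = 0%MM) ?mpolyX0 //.
by apply/mnmP => -[i i4]; rewrite !mnmE; move: i i4 => [|[|[|[|]]]].
Qed.

Lemma seval_var (i : 'I_4) : seval (svar i) = 'X_i.
Proof.
rewrite /seval big_seq1 scale1r; congr 'X_[_]; apply/mnmP => j.
by rewrite !mnmE; case: i j => [[|[|[|[|?]]]] ?] [[|[|[|[|?]]]] ?].
Qed.

Lemma seval_exp p n : seval (sexp p n) = seval p ^+ n.
Proof.
rewrite /sexp; elim: n => [|n IHn]; first by rewrite seval_one.
by rewrite iterS seval_mul IHn exprS.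
Qed.

Lemma mcoeff_seval_neq0 p m : (seval p)@_m != 0 ->
  exists2 t, t \in p & m = mon t.2 /\ scoef p t.2 != 0.
Proof.
have [e ->] := mon_surj m; rewrite mcoeff_seval => pe.
suff [t tp eqe] : exists2 t, t \in p & t.2 = e.
  by exists t => //; rewrite eqe; split=> //; apply: contraNneq pe => ->.
elim: p pe => [|t p IHp] /=; first by rewrite eqxx.
case: (t.2 =P e) => [<- _|_ /IHp[u up <-]]; first by exists t; rewrite ?mem_head.
by exists u; rewrite // inE up orbT.
Qed.

Lemma seval_degree (d : int) p :
  all (fun t => (expo_deg t.2)%:Z == d) p -> of_degree d (seval p).
Proof.
move=> /allP pd; apply/of_degreeP => m /mcoeff_seval_neq0[t /pd /eqP <- [-> _]].
by rewrite mdeg_mon.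
Qed.

Lemma seval_no_constant p :
  all (fun t => 0 < expo_deg t.2)%N p -> (seval p)@_0%MM = 0.
Proof.
move=> /allP pd; apply/eqP; apply: contraT => /mcoeff_seval_neq0[t /pd tp [t0 _]].
by move: tp; rewrite -mdeg_mon -t0 mdeg0.
Qed.

Definition in_vars_ideal (L : seq nat) (f : S) :=
  exists r : nat -> S, f = \sum_(l <- L) 'X_(inord l) * r l.

Lemma in_varsP (L : seq nat) p : all (fun l => l < 4)%N L -> uniq L ->
  in_vars L p -> in_vars_ideal L (seval p).
Proof.
move=> /allP L4 Lu /allP pL.
rewrite [seval p]mpolyE big_seq.
apply: (big_ind (in_vars_ideal L)) => [||m].
- by exists (fun _ => 0); rewrite big1 // => l _; rewrite mulr0.
- move=> _ _ [r ->] [r' ->]; exists (fun l => r l + r' l).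
  by rewrite -big_split; apply: eq_bigr => l _; rewrite mulrDr.
rewrite mcoeff_msupp => pm; have [t tp [eqm tn]] := mcoeff_seval_neq0 pm.
have := pL t tp; rewrite (negbTE tn) orbF => /hasP[l lL tl].
exists (fun l' => if l' == l then (seval p)@_m *: 'X_[m - U_(inord l)] else 0).
rewrite (bigD1_seq l) //= eqxx big1 ?addr0; last first.
  by move=> l' /negbTE ->; rewrite mulr0.
rewrite -scalerAr -mpolyXD addmC submK // lep1mP eqm mnmE inordK ?L4 //.
by rewrite -lt0n.
Qed.

Definition rows_mx n m (rows : seq (seq spoly)) : 'M[S]_(m, n) :=
  \matrix_(i, j) seval (nth [::] (nth [::] rows i) j).

Definition comb_col n (comb : seq (nat * spoly)) : 'cV[S]_n :=
  \sum_(t <- comb) seval t.2 *: \col_l (val l == t.1)%:R.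

Lemma rows_mx_comb n m rows comb (i : 'I_m) : all (fun t => t.1 < n)%N comb ->
  (rows_mx n m rows *m comb_col n comb) i 0 = seval (sdot (nth [::] rows i) comb).
Proof.
rewrite /comb_col /sdot; elim: comb => [|[j p] comb IHc] /=.
  by rewrite big_nil mulmx0 mxE seval_nil.
case/andP=> jn /IHc {}IHc.
rewrite big_cons mulmxDr mxE IHc seval_cat seval_mul; congr (_ + _).
rewrite -scalemxAr !mxE (bigD1 (Ordinal jn)) //= !mxE eqxx mulr1.
rewrite big1 ?addr0 1?mulrC // => l lj.
rewrite !mxE (_ : (val l == j) = false) ?mulr0 //.
by apply: contraNF lj => /eqP lj; apply/eqP/val_inj.
Qed.

End Evaluation.

(** * Surjectivity and injectivity by computation *)

Section Chain.
Variable k : fieldType.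
Local Notation S := {mpoly k[4]}.

(** On the quotient by J, the operator f^N has values in the multiples of g.  By
iteration f^(N n) has values in the multiples of g^n, which vanish. *)
Lemma nilpotent_step m (J : 'cV[S]_m -> Prop) (f g : S) N n :
  J 0 -> (forall u v, J u -> J v -> J (u + v)) ->
  (forall h v, J v -> J (h *: v)) ->
  (forall w, exists w', J (f ^+ N *: w - g *: w')) ->
  (forall w, J (g ^+ n *: w)) -> forall w, J (f ^+ (N * n) *: w).
Proof.
move=> J0 JD JZ step gn w.
suff [w' wJ] : exists w', J (f ^+ (N * n) *: w - g ^+ n *: w').
  by have := JD _ _ wJ (gn w'); rewrite subrK.
elim: n {gn} => [|n [w1 wJ]]; first by exists w; rewrite muln0 subrr.
have [w2 w2J] := step w1; exists w2.
have := JD _ _ (JZ (f ^+ N) _ wJ) (JZ (g ^+ n) _ w2J).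
rewrite !scalerBr !scalerA -exprD -mulnS [g ^+ n * f ^+ N]mulrC.
by rewrite addrA subrK -exprSr.
Qed.

Variables (n m : nat) (A : 'M[S]_(m, n)).

Definition image_mod (L : seq nat) (w : 'cV[S]_m) :=
  exists u r, w = A *m u + \sum_(l <- L) 'X_(inord l) *: r l.

Lemma image_modD L u v : image_mod L u -> image_mod L v -> image_mod L (u + v).
Proof.
move=> [u' [r ->]] [v' [s ->]]; exists (u' + v'), (fun l => r l + s l).
rewrite mulmxDr addrACA -big_split; congr (_ + _).
by apply: eq_bigr => l _; rewrite scalerDr.
Qed.

Lemma image_modZ L h v : image_mod L v -> image_mod L (h *: v).
Proof.
move=> [v' [s ->]]; exists (h *: v'), (fun l => h *: s l).
rewrite scalerDr scalemxAr scaler_sumr; congr (_ + _).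
by apply: eq_bigr => l _; rewrite !scalerA mulrC.
Qed.

Lemma image_mod_of_image L v : in_image A v -> image_mod L v.
Proof.
case=> u ->; exists u, (fun _ => 0).
by rewrite big1 ?addr0 // => l _; rewrite scaler0.
Qed.

Definition eventually_onto (i : 'I_4) :=
  exists N, forall w, in_image A ('X_i ^+ N *: w).

(** The variables in L act nilpotently on the cokernel of A, so they can be removed
one at a time from the modulus by [nilpotent_step]. *)
Lemma peel_variables L i N : (forall w, image_mod L ('X_i ^+ N *: w)) ->
  (forall l, l \in L -> eventually_onto (inord l)) -> eventually_onto i.
Proof.
elim: L N => [|l L IHL] N iN onto.
  by exists N => w; have [u [r ->]] := iN w; exists u; rewrite big_nil addr0.
have [nl ln] : eventually_onto (inord l) by apply: onto; rewrite mem_head.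
apply: (IHL (N * nl)%N) => [|l' l'L]; last by apply: onto; rewrite inE l'L orbT.
apply: (nilpotent_step (g := 'X_(inord l))).
- exact/image_mod_of_image/in_image0.
- exact: image_modD.
- exact: image_modZ.
- move=> w; have [u [r ->]] := iN w; exists (r l), u, r.
  by rewrite big_cons [_ + (_ + _)]addrCA [LHS]addrC addKr.
- by move=> w; apply: image_mod_of_image.
Qed.

Lemma eventually_onto_delta i : eventually_onto i ->
  exists N (delta : 'M_(n, m)), A *m delta = ('X_i ^+ N)%:M.
Proof.
case=> N onto; exists N.
have /fin_all_exists[d dP] j := onto (delta_mx j 0).
exists (\matrix_(s, j) d j s 0); apply/matrixP => s j.
have /matrixP/(_ s 0) := dP j; rewrite !mxE eqxx andbT => eqs.
rewrite -mulr_natr eqs; apply: eq_bigr => t _; by rewrite mxE.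
Qed.

End Chain.

Section ChainCheck.
Variable k : fieldType.
Local Notation S := {mpoly k[4]}.
Variables (n : nat) (rows : seq (seq spoly)).
Local Notation A := (rows_mx k n (size rows) rows).

Lemma column_okP L v N (j : 'I_(size rows)) comb :
  (v < 4)%N -> all (fun l => l < 4)%N L -> uniq L ->
  column_ok n rows L v N j comb ->
  image_mod A L ('X_(inord v) ^+ N *: delta_mx j 0).
Proof.
move=> v4 L4 Lu /andP[cn /allP rowsP].
have rowP (i : 'I_(size rows)) : exists r : nat -> S,
    ('X_(inord v) ^+ N *: delta_mx j 0 : 'cV_(size rows)) i 0 =
      (A *m comb_col k n comb) i 0 - \sum_(l <- L) 'X_(inord l) * r l.
  have /rowsP/(in_varsP k L4 Lu)[r eqr] : val i \in iota 0 (size rows).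
    by rewrite mem_iota /=.
  exists r; rewrite -eqr seval_cat rows_mx_comb // opprD addNKr.
  rewrite !mxE eqxx andbT val_eqE.
  case: (i == j); last by rewrite seval_nil oppr0 mulr0.
  by rewrite seval_opp opprK seval_exp mulr1 -(inordK v4) seval_var inord_val.
have [r rP] := fin_all_exists rowP.
exists (comb_col k n comb), (fun l => - \col_i r i l); apply/colP => i.
rewrite rP [RHS]mxE summxE -sumrN; congr (_ + _).
by apply: eq_bigr => l _; rewrite !mxE mulrN.
Qed.

(** By induction on the steps, each variable has a power that kills the cokernel:
it does so modulo the previous variables, which are nilpotent. *)
Lemma chain_okP L steps : all (fun l => l < 4)%N L -> uniq L ->
  chain_ok n rows L steps ->
  (forall l, l \in L -> eventually_onto A (inord l)) ->
  forall i, eventually_onto A i.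
Proof.
elim: steps L => [|[[v N] combs] steps IHs] L L4 Lu.
  move=> allL onto i; have {}allL : all (mem L) (iota 0 4) by [].
  move/allP: allL => allL.
  by rewrite -(inord_val i); apply/onto/allL; rewrite mem_iota /=.
rewrite /=; case/andP=> /andP[/andP[v4 vL] /allP colsP] stepsP onto.
apply: (IHs (v :: L)) => //=; rewrite ?v4 ?vL //.
move=> l; rewrite inE => /orP[/eqP -> {l}|/onto //].
apply: (peel_variables (N := N) (L := L)) => // w.
rewrite [w]col_sum_delta scaler_sumr.
apply: (big_ind (image_mod A L)) => [||j _].
- exact/image_mod_of_image/in_image0.
- exact: image_modD.
rewrite scalerA mulrC -scalerA; apply: image_modZ.
apply: column_okP => //; apply: colsP.
by rewrite mem_iota /=.
Qed.

Lemma chain_delta steps : chain_ok n rows [::] steps -> forall i : 'I_4,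
  exists N (delta : 'M_(n, size rows)), A *m delta = ('X_i ^+ N)%:M.
Proof. by move=> ok i; apply: eventually_onto_delta; apply: chain_okP ok _ i. Qed.

End ChainCheck.

Section Elimination.
Variable k : fieldType.
Local Notation S := {mpoly k[4]}.

Lemma mem_expos d e : ((expo_deg e)%:Z == d) -> e \in expos d.
Proof.
move=> /eqP <-; rewrite /expos mem_filter eqxx andTb.
case: e => [[[e0 e1] e2] e3]; set n := expo_deg _.
have lt_n : [&& e0 < n.+1, e1 < n.+1, e2 < n.+1 & e3 < n.+1]%N.
  by rewrite /n /expo_deg /=; lia.
case/and4P: lt_n => n0 n1 n2 n3.
have pairs i j : (i < n.+1)%N -> (j < n.+1)%N ->
    (i, j) \in [seq (i, j) | i <- iota 0 n.+1, j <- iota 0 n.+1].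
  by move=> ni nj; apply: allpairs_f; rewrite mem_iota.
exact: (allpairs_f (fun p q => (p, q.1, q.2) : expo)
  (pairs _ _ n0 n1) (pairs _ _ n2 n3)).
Qed.

Lemma column_index_uniq b : uniq (column_index b).
Proof.
apply: allpairs_uniq_dep; first exact: iota_uniq; last first.
  by move=> [i m] [j m'] _ _ /= [-> ->].
move=> j _; case: (nth 0 b j) => n //; rewrite /expos filter_uniq //.
have pairs_uniq : uniq [seq (i, j) | i <- iota 0 n.+1, j <- iota 0 n.+1].
  by apply: allpairs_uniq => [||[i1 i2] [j1 j2] _ _ //]; apply: iota_uniq.
apply: allpairs_uniq => // [[[i1 i2] [i3 i4]] [[j1 j2] [j3 j4]]] _ _ /=.
by case=> -> -> -> ->.
Qed.

Variables (b : seq int) (m : nat) (rows : seq (seq spoly)).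
Local Notation A := (rows_mx k (size b) m rows).

(** Entries are indexed by natural numbers, as the unknowns are. *)
Definition entry (v : 'cV[S]_(size b)) (j : nat) : S :=
  oapp (fun i : 'I_(size b) => v i 0) 0 (insub j).

Lemma entry_ord v (i : 'I_(size b)) : entry v i = v i 0.
Proof. by rewrite /entry valK. Qed.

Definition supported (v : 'cV[S]_(size b)) (l : seq (nat * expo)) :=
  forall j e, (entry v j)@_(mon e) != 0 -> (j, e) \in l.

Lemma supported_expansion v l : uniq l -> supported v l ->
  v = \sum_(t <- l) \col_i
        ((i == t.1 :> nat)%:R * ((entry v t.1)@_(mon t.2) *: 'X_[mon t.2])).
Proof.
move=> lu vl; apply/colP => i; apply/mpolyP => m'; have [e ->] := mon_surj m'.
rewrite summxE raddf_sum /=.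
have [vie|] := eqVneq (entry v i)@_(mon e) 0.
  rewrite -entry_ord vie big_seq big1 // => t tl; rewrite mxE.
  case: eqP => [<-|]; rewrite ?mul0r ?mcoeff0 // mul1r mcoeffZ mcoeffX.
  by rewrite (inj_eq mon_inj); case: eqP => [->|]; rewrite ?mulr0 // vie mul0r.
move=> /vl iel; rewrite (bigD1_seq (nat_of_ord i, e)) //= mxE eqxx mul1r.
rewrite mcoeffZ mcoeffX eqxx mulr1 entry_ord big1 ?addr0 //.
move=> [j f]; rewrite mxE xpair_eqE [j == _]eq_sym /=.
have [<- /= /negbTE fe|_ _] := eqVneq (nat_of_ord i) j; last first.
  by rewrite mul0r mcoeff0.
by rewrite mul1r mcoeffZ mcoeffX (inj_eq mon_inj) fe mulr0.
Qed.

Lemma unknown_coefE i e t :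
  ((A *m \col_j ((j == t.1 :> nat)%:R * 'X_[mon t.2])) i 0)@_(mon e) =
  (unknown_coef (nth [::] rows i) e t)%:~R *+ (t.1 < size b)%N.
Proof.
rewrite /unknown_coef -mcoeff_seval seval_mul.
have -> : seval k [:: (1, t.2)] = 'X_[mon t.2].
  by rewrite /seval big_seq1 scale1r.
rewrite mxE; case: ltnP => tb; rewrite ?mulr1n ?mulr0n.
  rewrite (bigD1 (Ordinal tb)) //= !mxE eqxx mul1r big1 ?addr0 // => l lt.
  rewrite !mxE (_ : (l == t.1 :> nat) = false) ?mul0r ?mulr0 //.
  by apply: contraNF lt => /eqP lt; apply/eqP/val_inj.
rewrite big1 ?mcoeff0 // => l _.
rewrite !mxE (_ : (l == t.1 :> nat) = false) ?mul0r ?mulr0 //.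
by apply/negbTE; rewrite neq_ltn (leq_trans (ltn_ord l)).
Qed.

Lemma isolated_zero v l t : size rows = m -> uniq l -> supported v l -> t \in l ->
  A *m v = 0 -> isolated rows l t -> (entry v t.1)@_(mon t.2) = 0.
Proof.
move=> szr lu vl tl vK /hasP[row rowP /hasP[u _ /andP[unit_t /allP other]]].
set e := expo_add u.2 t.2 in unit_t other.
have [tb|tb] := ltnP t.1 (size b); last first.
  by rewrite /entry insubF ?mcoeff0 // ltnNge tb.
pose i := index row rows; have im : (i < m)%N by rewrite -szr index_mem.
have rowE : nth [::] rows (Ordinal im) = row by apply: nth_index.
have : ((A *m v) (Ordinal im) 0)@_(mon e) = 0 by rewrite vK mxE mcoeff0.
rewrite {1}(supported_expansion lu vl) mulmx_sumr summxE raddf_sum /=.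
have coefE t' : ((A *m \col_i0 ((i0 == t'.1 :> nat)%:R *
      ((entry v t'.1)@_(mon t'.2) *: 'X_[mon t'.2]))) (Ordinal im) 0)@_(mon e) =
    (entry v t'.1)@_(mon t'.2) * ((unknown_coef row e t')%:~R *+ (t'.1 < size b)%N).
  rewrite -[in RHS]rowE -unknown_coefE -mcoeffZ; congr mcoeff.
  rewrite !mxE scaler_sumr; apply: eq_bigr => s _.
  by rewrite !mxE -!scalerAr.
rewrite (bigD1_seq t) //= coefE tb mulr1n big_seq_cond big1 => [|t' /andP[t'l t't]].
  rewrite addr0 => /eqP; rewrite mulf_eq0 => /orP[/eqP //|].
  by move: unit_t; rewrite !inE => /orP[] /eqP ->; rewrite ?rmorphN ?oppr_eq0 oner_eq0.
have := other _ t'l; rewrite (negbTE t't) coefE /= => /eqP ->.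
by rewrite mul0rn mulr0.
Qed.

Lemma supported_eliminate v n l : size rows = m -> uniq l -> supported v l ->
  A *m v = 0 -> supported v (eliminate rows n l).
Proof.
move=> szr lu vl vK; rewrite /eliminate.
set step := fun l => [seq t <- l | ~~ isolated rows l t].
suff : uniq (iter n step l) /\ supported v (iter n step l) by case=> _ vs; exact: vs.
elim: n => [//|n [IHu IHs]]; rewrite iterS; split; first exact: filter_uniq.
move=> j e je; have jl := IHs _ _ je; rewrite mem_filter jl andbT.
apply: contraNN je => iso; apply/eqP.
exact: (isolated_zero szr IHu IHs jl vK iso).
Qed.

Lemma injective_degree0P v : size rows = m -> injective_degree0 b rows ->
  in_piece 0 v -> A *m v = 0 -> v = 0.
Proof.
move=> szr /nilP el v0 vK.
have v_l : supported v (column_index b).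
  move=> j e; have [jb|jb] := ltnP j (size b); last first.
    by rewrite /entry insubF ?mcoeff0 ?eqxx // ltnNge jb.
  rewrite (entry_ord v (Ordinal jb)) => ve.
  apply/allpairsPdep; exists j, e; split=> //; first by rewrite mem_iota.
  apply: mem_expos; move/in_pieceP: v0 => /(_ (Ordinal jb))/of_degreeP/(_ _ ve).
  by rewrite mdeg_mon addr0 => ->.
have := supported_eliminate (size (column_index b)) szr (column_index_uniq b) v_l vK.
rewrite el => sup0; apply/colP => i; apply/mpolyP => m'; rewrite mxE mcoeff0.
have [e ->] := mon_surj m'; apply/eqP; apply: contraT.
by rewrite -entry_ord => /sup0.
Qed.

End Elimination.

(** * The six monads *)

(** The columns of beta = J alpha^T, where J is antidiagonal, with entries 1 in its
upper half and -1 in its lower half.  Since J^T J = 1, a solution of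
alpha delta = X_v^N gives the solution J delta for the transpose of beta: hence
the same transformation in [dual_comb]. *)
Definition dual_row (n : nat) (row : seq spoly) : seq spoly :=
  [seq (if (l < n./2)%N then id else sopp) (nth [::] row (n.-1 - l))
    | l <- iota 0 n].

Definition dual_comb (n : nat) (comb : seq (nat * spoly)) : seq (nat * spoly) :=
  [seq (let l := (n.-1 - t.1)%N in (l, (if (l < n./2)%N then id else sopp) t.2))
    | t <- comb].

Definition row_comb (n : nat) (row : seq spoly) : seq (nat * spoly) :=
  [seq (l, nth [::] row l) | l <- iota 0 n].

(** The degrees of beta are checked on its transpose, whose rows are [drows], which
exchanges source and target and hence the signs of b and c. *)
Definition monad_check (c b a : seq int) (rows : seq (seq spoly))
    (steps : seq (nat * nat * seq (seq (nat * spoly)))) : bool :=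
  let n := size b in
  let drows := map (dual_row n) rows in
  let dsteps := [seq (s.1, map (dual_comb n) s.2) | s <- steps] in
  [&& size rows == size a, size drows == size c, n == (size a + size c + 2)%N,
      foldr +%R 0 b == foldr +%R 0 a + foldr +%R 0 c - 1,
      is_hom_rows b a rows, is_hom_rows (map -%R b) (map -%R c) drows,
      all (fun row => all (fun drow =>
          in_vars [::] (sdot row (row_comb n drow))) drows) rows,
      chain_ok n rows [::] steps, chain_ok n drows [::] dsteps
    & injective_degree0 b rows].

Section Criterion.
Variable k : fieldType.
Local Notation S := {mpoly k[4]}.

Lemma is_hom_rowsP b a rows (i : 'I_(size a)) (j : 'I_(size b)) :
  is_hom_rows b a rows ->
  of_degree (a`_i - b`_j) (rows_mx k (size b) (size a) rows i j) /\
  (rows_mx k (size b) (size a) rows i j)@_0%MM = 0.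
Proof.
have mem_ord n (l : 'I_n) : val l \in iota 0 n by rewrite mem_iota /=.
move=> /allP/(_ _ (mem_ord _ i))/allP/(_ _ (mem_ord _ j)) termsP.
rewrite mxE; split.
  by apply: seval_degree; apply: sub_all termsP => t /andP[].
by apply: seval_no_constant; apply: sub_all termsP => t /andP[].
Qed.

Lemma comb_col_row n row :
  comb_col k n (row_comb n row) = \col_l seval k (nth [::] row l).
Proof.
apply/colP => i; rewrite /comb_col big_map summxE mxE.
have -> : iota 0 n = index_iota 0 n by rewrite /index_iota subn0.
rewrite big_mkord (bigD1 i) //= !mxE eqxx mulr1 big1 ?addr0 // => l li.
by rewrite !mxE eq_sym val_eqE (negbTE li) mulr0.
Qed.

Lemma chain_delta_size n m rows steps : size rows = m ->
  chain_ok n rows [::] steps -> forall i : 'I_4,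
  exists N (delta : 'M[S]_(n, m)), rows_mx k n m rows *m delta = ('X_i ^+ N)%:M.
Proof. by move=> <-; apply: chain_delta. Qed.

(** The matrices that factor a power of X_i through alpha or beta need not be
graded: a component of the right degree does the same. *)
Lemma rank2_monad (c b a : seq int)
    (beta : 'M[S]_(size b, size c)) (alpha : 'M[S]_(size a, size b)) :
  is_hom 0 beta -> is_hom 0 alpha -> alpha *m beta = 0 ->
  no_constant_term alpha -> no_constant_term beta ->
  (forall i : 'I_4, exists N (gamma : 'M_(size c, size b)),
     gamma *m beta = ('X_i ^+ N)%:M) ->
  (forall i : 'I_4, exists N (delta : 'M_(size b, size a)),
     alpha *m delta = ('X_i ^+ N)%:M) ->
  (forall v : 'cV_(size b), in_piece 0 v -> alpha *m v = 0 -> v = 0) ->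
  size b = (size a + size c + 2)%N ->
  \sum_(x <- b) x = \sum_(x <- a) x + \sum_(x <- c) x - 1 ->
  has_minimal_monad_with_stable_cohomology k c b a.
Proof.
move=> betaP alphaP ab0 alpha0 beta0 gammaP deltaP no_section rank2 degree_odd.
exists beta, alpha; split; last exact: stable_of_no_section.
  split=> // [x|x] [i xi].
    have [N [gamma gP]] := gammaP i.
    exists N, ('X_i ^+ N), (\matrix_(s, t) hpart (c`_s + N%:Z - b`_t) (gamma s t)).
    split.
    - exact: of_degree_varX.
    - by rewrite rmorphXn /= mevalXU expf_neq0.
    - by move=> s t; rewrite mxE of_degree_hpart.
    apply/matrixP => s t; rewrite !mxE.
    pose d := c`_s + N%:Z - c`_t.
    have /matrixP/(_ s t) := gP; rewrite !mxE => /(congr1 (hpart d)).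
    rewrite hpart_sum => gst.
    transitivity (hpart d ('X_i ^+ N *+ (s == t) : S)).
      rewrite -gst; apply: eq_bigr => l _; rewrite mxE (hpart_mull _ _ (betaP l t)).
      by congr (hpart _ _ * _); rewrite /d; lia.
    rewrite /d; case: eqP => [->|_]; last by rewrite hpart0.
    by rewrite addrAC subrr add0r hpart_id //; apply: of_degree_varX.
  have [N [delta dP]] := deltaP i; pose ev (f : S) := f.@[x].
  move=> w; exists (map_mx ev delta *m ((x i ^+ N)^-1 *: w)).
  rewrite -/ev mulmxA -map_mxM dP map_scalar_mx mul_scalar_mx scalerA /ev.
  by rewrite rmorphXn /= mevalXU divff ?scale1r // expf_neq0.
by apply: minimal_of_no_constant => //; apply: beta_inj gammaP.
Qed.

Theorem monad_checkP c b a rows steps : monad_check c b a rows steps ->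
  has_minimal_monad_with_stable_cohomology k c b a.
Proof.
rewrite /monad_check; set n := size b; set drows := map _ rows.
set dsteps := [seq _ | s <- steps].
case/and5P=> /eqP sza /eqP szc /eqP rank2 /eqP deg.
case/and5P=> ahom bhom /allP iso achain /andP[bchain noS].
pose alpha := rows_mx k n (size a) rows.
pose betaT := rows_mx k n (size c) drows.
have bhom' (l : 'I_(size b)) (j : 'I_(size c)) :
    of_degree (b`_l - c`_j) (betaT j l) /\ (betaT j l)@_0%MM = 0.
  have := @is_hom_rowsP (map -%R b) (map -%R c) drows
    (cast_ord (esym (size_map _ _)) j) (cast_ord (esym (size_map _ _)) l) bhom.
  by rewrite !mxE /= !(nth_map 0) // opprK addrC.
apply: (@rank2_monad c b a betaT^T alpha) => //.
- move=> l j; have [bd _] := bhom' l j; by rewrite mxE addr0.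
- by move=> i j; rewrite addr0; have [] := @is_hom_rowsP b a rows i j ahom.
- apply/matrixP => i j; rewrite [RHS]mxE.
  have -> : (alpha *m betaT^T) i j =
      (alpha *m comb_col k n (row_comb n (nth [::] drows j))) i 0.
    by rewrite comb_col_row !mxE; apply: eq_bigr => l _; rewrite !mxE.
  rewrite rows_mx_comb; last by apply/allP => _ /mapP[l + ->]; rewrite mem_iota.
  have /allP iso_i : all (fun drow => in_vars [::]
      (sdot (nth [::] rows i) (row_comb n drow))) drows.
    by apply: iso; rewrite mem_nth // sza.
  have /iso_i/(@in_varsP k [::] _ isT isT)[r ->] : nth [::] drows j \in drows.
    by rewrite mem_nth // szc.
  by rewrite big_nil.
- by move=> i j; have [] := @is_hom_rowsP b a rows i j ahom.
- by move=> l j; have [_ b0] := bhom' l j; rewrite mxE.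
- move=> i; have [N [delta dP]] := chain_delta_size szc bchain i.
  exists N, delta^T; apply: trmx_inj; rewrite trmx_mul !trmxK dP.
  by rewrite tr_scalar_mx.
- exact: chain_delta_size sza achain.
- by move=> v; apply: (injective_degree0P sza).
- by rewrite -!foldrE.
Qed.

End Criterion.

Declare Scope spoly_scope.
Delimit Scope spoly_scope with sp.
Notation "p + q" := (p ++ q) : spoly_scope.
Notation "- p" := (sopp p) : spoly_scope.
Notation "p * q" := (smul p q) : spoly_scope.
Notation "p ^ n" := (sexp p n%N) : spoly_scope.
Notation "0" := ([::] : spoly) : spoly_scope.
Notation "1" := sone : spoly_scope.

Definition entry_at (j : nat) (p : spoly) : nat * spoly := (j, p).
Definition stage (v N : nat) (combs : seq (seq (nat * spoly))) := (v, N, combs).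
Arguments entry_at j%_N p%_sp.
Arguments stage (v N)%_N combs%_sp.

Section Examples.
Local Open Scope spoly_scope.
Let x0 := svar 0%N.
Let x1 := svar 1%N.
Let x2 := svar 2%N.
Let x3 := svar 3%N.

(** Columns 0 and 4 have rank 2 where x0 is nonzero, and columns 3 and 5 where
x0 = 0 and x3 is nonzero.  On the line x0 = x3 = 0, there remain the columns
(0, x1^2), (x1, x2^2) and (x2, 0).  The term x0^2 x1 makes the rows orthogonal. *)
Definition rows8 := [::
  [:: x0; x1; x2; x3^2; 0; 0];
  [:: x1^2; x2^2; x0*x3; 0; - x0^3; x3^3 + x0^2*x1]].
Definition stages8 := [::
  stage 0 4 [:: [:: entry_at 0 (x0^3); entry_at 4 (x1^2)]; [:: entry_at 4 (- x0)]];
  stage 3 3 [:: [:: entry_at 3 x3]; [:: entry_at 5 1]];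
  stage 1 3 [:: [:: entry_at 1 (x1^2); entry_at 0 (- x2^2)]; [:: entry_at 0 x1]];
  stage 2 2 [:: [:: entry_at 2 x2]; [:: entry_at 1 1]]].

(** The first two rows are of instanton type: shifts of (x0, x1) and of (x2^2, x3^2),
orthogonal to each other.  The third one is orthogonal to them; on the plane
x0 = 0, its middle part depends on them at finitely many points only, where
x1^4 + x2^4 is nonzero. *)
Definition rows9 := [::
  [:: 0; x0; x1; 0; x2^2; x3^2; 0; 0];
  [:: 0; 0; x0; x1; 0; x2^2; x3^2; 0];
  [:: x0; x1*x3; 0; x0*x2; x3^3; 0; x2^3; x1^4 + x2^4]].
Definition stages9 := [::
  stage 0 3 [:: [:: entry_at 1 (x0^2); entry_at 0 (- x0*x1*x3)];
                [:: entry_at 2 (x0^2); entry_at 1 (- x0*x1); entry_at 0 (x1^2*x3)];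
                [:: entry_at 0 (x0^2)]];
  stage 1 5 [:: [:: entry_at 2 (x1^4)]; [:: entry_at 3 (x1^4)];
                [:: entry_at 7 x1; entry_at 6 (- x1*x2); entry_at 3 (x2*x3^2)]];
  stage 2 8 [:: [:: entry_at 4 (x2^6); entry_at 7 (- x2^2*x3^3)];
                [:: entry_at 5 (x2^6); entry_at 4 (- x2^4*x3^2); entry_at 7 (x3^5)];
                [:: entry_at 7 (x2^4)]];
  stage 3 3 [:: [:: entry_at 5 x3]; [:: entry_at 6 x3]; [:: entry_at 4 1]]].

(** Off the line x0 = x1 = 0, the first three columns have rank 2; on this line, the
last three do. *)
Definition rows10 := [::
  [:: x0; x1; 0; 0; x2^4; x3^4];
  [:: 0; x0; x1^2; x3^3; 0; x2^4]].
Definition stages10 := [::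
  stage 0 2 [:: [:: entry_at 0 x0]; [:: entry_at 1 x0; entry_at 0 (- x1)]];
  stage 1 2 [:: [:: entry_at 1 x1]; [:: entry_at 2 1]];
  stage 2 8 [:: [:: entry_at 4 (x2^4)]; [:: entry_at 5 (x2^4); entry_at 4 (- x3^4)]];
  stage 3 4 [:: [:: entry_at 5 1]; [:: entry_at 3 x3]]].

(** The first row vanishes at no point.  Off the plane x0 = 0, columns 1, 2 and 3
have rank 3; on this plane and off the line x0 = x1 = 0, columns 0, 1 and 4 do.
On this line, the first row is (x3^3, - x2^3) in columns 5 and 6, the other rows have
x2 and - x2^2 in columns 0 and 3; at the point x2 = 0, columns 5, 4 and 6 are
diagonal. *)
Definition rows12 := [::
  [:: 0; 0; 0; x0; x1^2; x3^3; - x2^3; x1*x2^2];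
  [:: x2; x1; x0; 0; x3^3; 0; 0; x3^4];
  [:: x1; x0; 0; - x2^2; - x2^3; 0; x3^4; - x2*x3^3]].
Definition stages12 := [::
  stage 0 3 [:: [:: entry_at 3 (x0^2); entry_at 1 (x0*x2^2); entry_at 2 (- x1*x2^2)];
                [:: entry_at 2 (x0^2)];
                [:: entry_at 1 (x0^2); entry_at 2 (- x0*x1)]];
  stage 1 4 [:: [:: entry_at 4 (x1^2); entry_at 1 (- x1*x3^3);
                    entry_at 0 (x1*x2^3); entry_at 1 (- x2^4)];
                [:: entry_at 1 (x1^3)];
                [:: entry_at 0 (x1^3); entry_at 1 (- x1^2*x2)]];
  stage 2 5 [:: [:: entry_at 6 (- x2^2); entry_at 3 (- x3^4)];
                [:: entry_at 0 (x2^4)];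
                [:: entry_at 3 (- x2^3)]];
  stage 3 4 [:: [:: entry_at 5 x3]; [:: entry_at 4 x3]; [:: entry_at 6 1]]].

(** Off the plane x0 = 0, the first two columns have rank 2.  On this plane, the
four middle columns have rank 2 except at finitely many points, where
x1^6 + x2^6 is nonzero. *)
Definition rows14 := [::
  [:: 0; x0; x1; x3^2; x2^2; 0];
  [:: x0; x1*x2^2; x0*x3^2; x2^4; x3^4; x1^6 + x2^6]].
Definition stages14 := [::
  stage 0 2 [:: [:: entry_at 1 x0; entry_at 0 (- x1*x2^2)]; [:: entry_at 0 x0]];
  stage 1 7 [:: [:: entry_at 2 (x1^6)]; [:: entry_at 5 x1; entry_at 1 (- x2^4)]];
  stage 2 8 [:: [:: entry_at 4 (x2^6); entry_at 5 (- x3^4)]; [:: entry_at 5 (x2^2)]];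
  stage 3 4 [:: [:: entry_at 3 (x3^2)]; [:: entry_at 4 1]]].

(** The same pattern as [rows14], with other degrees. *)
Definition rows17 := [::
  [:: 0; x0; x1; x3^4; x2^4; 0];
  [:: x0; x1*x2; x0*x3; x2^5; x3^5; x1^6 + x2^6]].
Definition stages17 := [::
  stage 0 2 [:: [:: entry_at 1 x0; entry_at 0 (- x1*x2)]; [:: entry_at 0 x0]];
  stage 1 7 [:: [:: entry_at 2 (x1^6)]; [:: entry_at 5 x1; entry_at 1 (- x2^5)]];
  stage 2 10 [:: [:: entry_at 4 (x2^6); entry_at 5 (- x3^5)]; [:: entry_at 5 (x2^4)]];
  stage 3 5 [:: [:: entry_at 3 x3]; [:: entry_at 4 1]]].
End Examples.

Theorem theorem16 (k : closedFieldType) (char0 : [pchar k] =i pred0) :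
  (* P8 *)
  has_minimal_monad_with_stable_cohomology k
    [:: -2; -3]
    (nseq 3 0 ++ nseq 3 (-1))
    [:: 1; 2] /\
  (* P9 *)
  has_minimal_monad_with_stable_cohomology k
    (nseq 2 (-2) ++ [:: -3])
    ([:: 1] ++ nseq 3 0 ++ nseq 3 (-1) ++ [:: -2])
    (nseq 2 1 ++ [:: 2]) /\
  (* P10 *)
  has_minimal_monad_with_stable_cohomology k
    (nseq 2 (-3))
    (nseq 2 1 ++ [:: 0; -1] ++ nseq 2 (-2))
    (nseq 2 2) /\
  (* P12 *)
  has_minimal_monad_with_stable_cohomology k
    ([:: -2] ++ nseq 2 (-3))
    (nseq 3 1 ++ [:: 0; -1] ++ nseq 3 (-2))
    ([:: 1] ++ nseq 2 2) /\
  (* P14 *)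
  has_minimal_monad_with_stable_cohomology k
    [:: -2; -4]
    ([:: 2] ++ nseq 2 0 ++ nseq 2 (-1) ++ [:: -3])
    [:: 1; 3] /\
  (* P17 *)
  has_minimal_monad_with_stable_cohomology k
    [:: -3; -4]
    ([:: 2] ++ nseq 2 1 ++ nseq 2 (-2) ++ [:: -3])
    [:: 2; 3].
Proof.
do ?split.
- by apply: (@monad_checkP k _ _ _ rows8 stages8); vm_compute.
- by apply: (@monad_checkP k _ _ _ rows9 stages9); vm_compute.
- by apply: (@monad_checkP k _ _ _ rows10 stages10); vm_compute.
- by apply: (@monad_checkP k _ _ _ rows12 stages12); vm_compute.
- by apply: (@monad_checkP k _ _ _ rows14 stages14); vm_compute.
- by apply: (@monad_checkP k _ _ _ rows17 stages17); vm_compute.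
Qed.
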